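(* Let $f:\mathbb{R}^n\times\mathbb{R}^m\to\mathbb{R}^n$ be locally Lipschitz with $f(0,\dots,0)=0$, let $\kappa_1,\dots,\kappa_m\in C^1(\mathbb{R}^n;\mathbb{R})$ be control laws making $\dot X=f(X,\kappa_1(X),\dots,\kappa_m(X))$ globally asymptotically stable, and let $\mathcal{X}\subset\mathbb{R}^n$, $\mathcal{U}\subset\mathbb{R}$, $\Phi\subset\mathbb{R}_+$ be bounded domains. Assume there is $C_f>0$ such that $$|f(x_1,u_1,\dots,u_m)-f(x_2,u_{m+1},\dots,u_{2m})|\le C_f\Big(|x_1-x_2|+\sum_{i=1}^m|u_i-u_{m+i}|\Big)$$ for all $x_1,x_2\in\mathcal{X}$ and $u_1,\dots,u_{2m}\in\mathcal{U}$. For each $i\in\{1,\dots,m\}$, fix a compact set $K_i\subset\mathcal{X}\times C^1([0,1];\mathcal{U})^{m-i+1}\times\Phi$. Then for every $\epsilon>0$ there exist neural operators $\hat{\mathcal{P}}_i:K_i\to C^1([0,1];\mathbb{R}^n)$, $i=1,\dots,m$, approximating the predictor operators $\mathcal{P}_i$ in the sense that $$\sup_{(X,U_i,\dots,U_m,\varphi)\in K_i}\big\|\mathcal{P}_i(X,U_i,\dots,U_m,\varphi)-\hat{\mathcal{P}}_i(X,U_i,\dots,U_m,\varphi)\big\|_{L^\infty}<\epsilon .$$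
   Context: $\mathbb{R}_+$ is the set of positive reals, $|\cdot|$ the Euclidean norm, and $\|g\|_{L^\infty}=\sup_{s\in[0,1]}|g(s)|$. Predictor operators. For $i\in\{1,\dots,m\}$, $\mathcal{P}_i:\mathbb{R}^n\times C^1([0,1];\mathbb{R})^{m-i+1}\times\mathbb{R}_+\to C^1([0,1];\mathbb{R}^n)$ maps $(Q,U_i,\dots,U_m,\varphi)$ to the function $P_i$ satisfying $$P_i(s)=Q+\varphi\int_0^sf\big(P_i(\theta),\kappa_1(P_i(\theta)),\dots,\kappa_{i-1}(P_i(\theta)),U_i(\theta),\dots,U_m(\theta)\big)\,d\theta,\quad s\in[0,1].$$ (The definition presupposes that this solution exists on $[0,1]$.) Neural operator. Given a channel dimension $d_c>0$, a neural operator is a map $\hat\Psi$ between spaces of continuous vector-valued functions on a bounded domain with Lipschitz boundary (here the interval $[0,1]$; vector and scalar inputs $X,\varphi$ are regarded as constant functions) having the compositional form $\hat\Psi=\mathcal{Q}\circ\mathcal{L}_L\circ\dots\circ\mathcal{L}_1\circ\mathcal{R}$, where: - the lifting layer $\mathcal{R}$ sends a function $c$ to $x\mapsto R(c(x),x)\in\mathbb{R}^{d_c}$, with $R$ a learnable neural network between finite-dimensional Euclidean spaces; - each hidden layer is $(\mathcal{L}_lv)(x)=\sigma\big(W_lv(x)+b_l+(\mathcal{K}_lv)(x)\big)$, with learnable $W_l\in\mathbb{R}^{d_c\times d_c}$, $b_l\in\mathbb{R}^{d_c}$, a smooth (infinitely differentiable) activation $\sigma:\mathbb{R}\to\mathbb{R}$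 acting componentwise, and $(\mathcal{K}_lv)(x)=\int K_l(x,y)v(y)\,dy$ over the domain, $K_l$ being a kernel function containing learnable parameters; - the projection layer $\mathcal{Q}$ sends a function $v$ to $x\mapsto Q(v(x),x)$, with $Q$ a finite-dimensional neural network. *)

(* Defs.v *)
From HB Require Import structures.
From mathcomp Require Import all_boot all_order all_algebra.
From mathcomp Require Import all_classical all_reals all_analysis.

Set Implicit Arguments.
Unset Strict Implicit.
Unset Printing Implicit Defensive.

Import Order.TTheory GRing.Theory Num.Theory.
Import numFieldNormedType.Exports.

Local Open Scope classical_set_scope.
Local Open Scope ring_scope.

(* Needed because the library norm on row vectors is the max norm. *)
Definition enorm (R : realType) n (v : 'rV[R]_n) : R :=
  Num.sqrt (\sum_j v 0 j ^+ 2).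

Definition Linf_norm (R : realType) n (g : R -> 'rV[R]_n) : \bar R :=
  ereal_sup [set (enorm (g s))%:E | s in `[0, 1]].

Definition bounded_domain (R : realType) (V : normedModType R) (A : set V) :=
  [/\ A !=set0, open A, connected A & bounded_set A].

Definition C1_on_space (R : realType) n (k : 'rV[R]_n -> R) :=
  (forall x, differentiable k x) /\ (forall v, continuous (fun x => 'D_v k x)).

(* Difference quotients of [u] at [t] with increments staying in [A]: at the
   endpoints of an interval [A] their limit is the one-sided derivative. *)
Definition quotients_within (R : realType) (V : normedModType R) (A : set R)
    (u : R -> V) (t : R) : set_system V :=
  (s - t)^-1 *: (u s - u t) @[s --> within A t^'].

Definition derive01 (R : realType) (V : normedModType R) (u : R -> V) (t : R)
    : V :=
  lim (quotients_within `[0, 1] u t).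

Definition is_C1_01 (R : realType) (V : normedModType R) (u : R -> V) :=
  (forall t, t \in `[0, 1] -> cvg (quotients_within `[0, 1] u t)) /\
  {within `[0, 1], continuous (derive01 u)}.

(* C^1([0,1]; V). An element is represented by a function on the line of which
   only the restriction to [0, 1] matters. *)
Record C1_01 (R : realType) (V : normedModType R) := MkC1 {
  C1_fun :> R -> V;
  C1_funP : is_C1_01 C1_fun
}.

HB.instance Definition _ (R : realType) (V : normedModType R) :=
  gen_eqMixin (C1_01 V).
HB.instance Definition _ (R : realType) (V : normedModType R) :=
  gen_choiceMixin (C1_01 V).

Definition C1_jet (R : realType) (V : normedModType R) (u : C1_01 V) :
    {uniform` [set` `[0, 1 : R]] -> V} *
    {uniform` [set` `[0, 1 : R]] -> V} :=
  (C1_fun u, derive01 u).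

(* The C^1 topology: uniform convergence on [0, 1] of the function and of its
   derivative. *)
HB.instance Definition _ (R : realType) (V : normedModType R) :=
  Topological.copy (C1_01 V) (initial_topology (@C1_jet R V)).

Definition is_solution (R : realType) n (F : 'rV[R]_n -> 'rV[R]_n)
    (x : R -> 'rV[R]_n) :=
  forall t, 0 <= t -> quotients_within `[0, +oo[ x t --> F (x t).

(* Solutions are global forward ones; the last clause excludes finite escape
   times. *)
Definition globally_asymptotically_stable (R : realType) n
    (F : 'rV[R]_n -> 'rV[R]_n) :=
  [/\ F 0 = 0,
      forall e, 0 < e -> exists2 d, 0 < d &
        forall x, is_solution F x -> enorm (x 0) < d ->
        forall t, 0 <= t -> enorm (x t) < e,
      forall x, is_solution F x -> x t @[t --> +oo] --> (0 : 'rV[R]_n) &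
      forall x0, exists2 x, is_solution F x & x 0 = x0].

(* Indices start at 0, so that for [i : 'I_m] the controls [j < i] are given by
   the feedback laws and the [m - i] remaining ones by external inputs. *)
Definition predictor_dom (R : realType) n m (i : 'I_m) : Type :=
  'rV[R]_n * {ptws 'I_(m - i) -> C1_01 R} * R.

Definition mixed_control (R : realType) n m (kappa : 'I_m -> 'rV[R]_n -> R)
    (i : 'I_m) (x : 'rV[R]_n) (u : 'I_(m - i) -> R) : 'rV[R]_m :=
  \row_j match fintype.split (cast_ord (esym (subnKC (ltnW (ltn_ord i)))) j) with
         | inl _ => kappa j x
         | inr k => u k
         end.
Arguments mixed_control {R n m} kappa i x u.

(* The equation defines [p] on [0, 1]; its integrand is continuous whenever f,
   kappa, U and p are, so the integral is a genuine one. *)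
Definition is_predictor (R : realType) n m
    (f : 'rV[R]_n -> 'rV[R]_m -> 'rV[R]_n) (kappa : 'I_m -> 'rV[R]_n -> R)
    (i : 'I_m) (z : predictor_dom R n i) (p : R -> 'rV[R]_n) :=
  let: (X, U, phi) := z in
  forall s, s \in `[0, 1] ->
  p s = X + phi *: \row_j \int[lebesgue_measure]_(t in `[0, s])
    f (p t) (mixed_control kappa i (p t) (fun k => U k t)) 0 j.

(* Feedforward networks from R^p to R^q.  As vectors are rows, weight matrices
   act on the right.  The activation is applied between consecutive affine
   maps, not after the last one. *)
Inductive network (R : realType) : nat -> nat -> Type :=
| NetAffine p q of 'M[R]_(p, q) & 'rV[R]_q : network R p q
| NetLayer p q r of 'M[R]_(p, q) & 'rV[R]_q & network R q r : network R p r.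

Fixpoint network_eval (R : realType) (sigma : R -> R) p q
    (N : network R p q) : 'rV[R]_p -> 'rV[R]_q :=
  match N with
  | NetAffine _ _ W b => fun x => x *m W + b
  | NetLayer _ _ _ W b N' =>
      fun x => network_eval sigma N' (map_mx sigma (x *m W + b))
  end.

Record hidden_layer (R : realType) (d : nat) := HiddenLayer {
  weight : 'M[R]_d;
  bias : 'rV[R]_d;
  kernel : R -> R -> 'M[R]_d;
  kernel_continuous :
    {within `[0, 1] `*` `[0, 1], continuous (fun z : R * R => kernel z.1 z.2)}
}.

Definition hidden_eval (R : realType) (sigma : R -> R) d
    (l : hidden_layer R d) (v : R -> 'rV[R]_d) : R -> 'rV[R]_d :=
  fun x => map_mx sigma (v x *m weight l + bias l +
    \row_j \int[lebesgue_measure]_(y in `[0, 1]) (v y *m kernel l x y) 0 j).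

Definition smooth (R : realType) (g : R -> R) :=
  forall k x, derivable (derive1n k g) x 1.

(* The activation of the hidden layers is also that of the lifting and
   projection networks, whose last argument is the point of [0, 1]. *)
Record neural_operator (R : realType) (p q : nat) := NeuralOperator {
  channels : nat;
  channels_gt0 : (0 < channels)%N;
  activation : R -> R;
  activation_smooth : smooth activation;
  lifting : network R (p + 1) channels;
  hidden : seq (hidden_layer R channels);
  hidden_nonempty : (0 < size hidden)%N;
  projection : network R (channels + 1) q
}.

Definition neural_operator_eval (R : realType) p q (N : neural_operator R p q)
    (c : R -> 'rV[R]_p) : R -> 'rV[R]_q :=
  let sigma := activation N in
  let v0 := fun x => network_eval sigma (lifting N)
                       (row_mx (c x) (const_mx x)) in
  let v := foldl (fun w l => hidden_eval sigma l w) v0 (hidden N) in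
  fun x => network_eval sigma (projection N) (row_mx (v x) (const_mx x)).

Definition predictor_input (R : realType) n m (i : 'I_m)
    (z : predictor_dom R n i) : R -> 'rV[R]_(n + (m - i) + 1) :=
  let: (X, U, phi) := z in
  fun s => row_mx (row_mx X (\row_k U k s)) (const_mx phi).

(* Main.v *)
Require Import Defs.
From mathcomp Require Import all_boot all_order all_algebra.
From mathcomp Require Import all_classical all_reals all_analysis.
From mathcomp Require Import ring lra.
Import Order.TTheory GRing.Theory Num.Theory.
Import numFieldNormedType.Exports.
Set Implicit Arguments.
Unset Strict Implicit.
Unset Printing Implicit Defensive.
Local Open Scope classical_set_scope.
Local Open Scope ring_scope.

(** The activation is the square, so that by polarization the lifting and
    projection networks compute every polynomial exactly.  By Gronwall's
    inequality, and since the closed loop is Lipschitz on bounded sets, each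
    predictor is continuous for the L^2 distance of the inputs; compactness
    then gives finitely many centres z_j in K_i such that every z in K_i is
    close to some z_j, and P_i(z) is uniformly close to P_i(z_j) whenever z is
    close to z_j.  A single hidden layer computes the squares of the numbers
    int |z - z_j|^2, and its kernels, being arbitrary continuous functions,
    can store the curves P_i(z_j).  The projection network blends these curves
    with polynomial weights that select the centres close to z. *)

(** * Networks with square activation *)

Section Networks.
Context {R : realType}.

(** The $L^2$ distance is used because a hidden layer computes its square exactly: expanding
    $|z-z_j|^2$ leaves a constant, an inner product with the fixed curve $z_j$ and the integral of
    $|z|^2$, hence a bias plus a kernel integral of polynomially lifted values. The activation then
    squares every channel, so distances reach the projection with thresholds squared accordingly,
    and each stored curve is kept in two copies from whose squares it can be recovered.

    On the side of the dynamics, the closed loop is Lipschitz on bounded sets only, and nothing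
    bounds beforehand the trajectory of a nearby input. The comparison is therefore made with one
    fixed centre, whose trajectory is bounded, up to the first time at which the other trajectory
    leaves a tube around it. The admissible radius depends on the centre, which a finite cover
    tolerates. *)

Definition square (x : R) : R := x ^+ 2.

Lemma smooth_square : smooth square.
Proof.
have der (p : {poly R}) n :
    derive1n n (fun x => p.[x]) = (fun x => p^`(n).[x]).
  elim: n => [|n IH]; first by apply/funext => x; rewrite derivn0.
  by rewrite derive1nS IH; apply/funext => x; rewrite derivnS derivE.
have -> : square = fun x => ('X^2 : {poly R}).[x].
  by apply/funext => x; rewrite hornerXn.
by move=> k x; rewrite der; exact: derivable_horner.
Qed.

(** A closure property of functions on an arbitrary [X], not a type of formal polynomials: the same
    predicate then applies to coordinates of rows, to the channels of a hidden layer, and to curves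
    by substitution. *)
Inductive polynomial_in (X I : Type) (v : I -> X -> R) : (X -> R) -> Prop :=
| polynomial_var i : polynomial_in v (v i)
| polynomial_cst c : polynomial_in v (fun=> c)
| polynomial_add g h : polynomial_in v g -> polynomial_in v h ->
    polynomial_in v (fun x => g x + h x)
| polynomial_mul g h : polynomial_in v g -> polynomial_in v h ->
    polynomial_in v (fun x => g x * h x).

Lemma polynomial_sub (X I : Type) (v : I -> X -> R) g h :
  polynomial_in v g -> polynomial_in v h ->
  polynomial_in v (fun x => g x - h x).
Proof.
move=> Pg Ph; rewrite (_ : (fun x => _) = fun x => g x + (-1) * h x).
  by apply: polynomial_add => //; apply: polynomial_mul => //;
    exact: polynomial_cst.
by apply/funext => x; rewrite mulN1r.
Qed.

Lemma polynomial_exp (X I : Type) (v : I -> X -> R) g n :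
  polynomial_in v g -> polynomial_in v (fun x => g x ^+ n).
Proof.
move=> Pg; elim: n => [|n IH]; first exact: polynomial_cst.
by under eq_fun do rewrite exprS; exact: polynomial_mul.
Qed.

Lemma polynomial_sum (X I : Type) (v : I -> X -> R) (J : Type) (s : seq J)
    (g : J -> X -> R) : (forall j, polynomial_in v (g j)) ->
  polynomial_in v (fun x => \sum_(j <- s) g j x).
Proof.
move=> Pg; elim: s => [|j s IH].
  by under eq_fun do rewrite big_nil; exact: polynomial_cst.
by under eq_fun do rewrite big_cons; exact: polynomial_add.
Qed.

Lemma polynomial_prod (X I : Type) (v : I -> X -> R) (J : Type) (s : seq J)
    (P : pred J) (g : J -> X -> R) : (forall j, polynomial_in v (g j)) ->
  polynomial_in v (fun x => \prod_(j <- s | P j) g j x).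
Proof.
move=> Pg; elim: s => [|j s IH].
  by under eq_fun do rewrite big_nil; exact: polynomial_cst.
under eq_fun do rewrite big_cons.
by case: (P j) => //; exact: polynomial_mul.
Qed.

Lemma polynomial_comp (X Y I J : Type) (v : I -> X -> R) (w : J -> Y -> R)
    (phi : Y -> X) g : (forall i, polynomial_in w (fun y => v i (phi y))) ->
  polynomial_in v g -> polynomial_in w (fun y => g (phi y)).
Proof.
move=> Pv; elim=> {g} [i|c|g h _ Pg _ Ph|g h _ Pg _ Ph] //.
- exact: polynomial_cst.
- exact: polynomial_add.
- exact: polynomial_mul.
Qed.

Lemma const_mxE m n (c : R) i j : (const_mx c : 'M[R]_(m, n)) i j = c.
Proof. by rewrite mxE. Qed.

Definition coordinate p (j : 'I_p) (x : 'rV[R]_p) : R := x 0 j.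

Definition computed p q (F : 'rV[R]_p -> 'rV[R]_q) : Prop :=
  exists N : network R p q, network_eval square N =1 F.

Definition affine p (g : 'rV[R]_p -> R) : Prop :=
  exists w : 'I_p -> R, exists b, forall x, g x = \sum_k x 0 k * w k + b.

Lemma affine_coord p (k : 'I_p) : affine (fun x => x 0 k).
Proof.
exists (fun l => (l == k)%:R), 0 => x; rewrite addr0 (bigD1 k)//= eqxx mulr1.
by rewrite big1 ?addr0// => l /negbTE->; rewrite mulr0.
Qed.

Lemma affine_cst p (c : R) : affine (fun _ : 'rV[R]_p => c).
Proof.
by exists (fun=> 0), c => x; rewrite big1 ?add0r// => k _; rewrite mulr0.
Qed.

Lemma affine_add p (g h : 'rV[R]_p -> R) :
  affine g -> affine h -> affine (fun x => g x + h x).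
Proof.
move=> [w [b gE]] [w' [b' hE]]; exists (fun k => w k + w' k), (b + b') => x.
rewrite gE hE addrACA -big_split/=; congr (_ + _).
by apply: eq_bigr => k _; rewrite mulrDr.
Qed.

Lemma affine_scale p (c : R) (g : 'rV[R]_p -> R) :
  affine g -> affine (fun x => c * g x).
Proof.
move=> [w [b gE]]; exists (fun k => c * w k), (c * b) => x.
by rewrite gE mulrDr mulr_sumr; congr (_ + _); apply: eq_bigr => k _; ring.
Qed.

Lemma affine_opp p (g : 'rV[R]_p -> R) :
  affine g -> affine (fun x => - g x).
Proof.
by under [X in _ -> affine X]eq_fun do rewrite -mulN1r; exact: affine_scale.
Qed.

Lemma computed_affine p q (F : 'rV[R]_p -> 'rV[R]_q) :
  (forall j, affine (fun x => F x 0 j)) -> computed F.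
Proof.
move=> /choice[w /choice[b FE]].
exists (NetAffine (\matrix_(k, j) w j k) (\row_j b j)) => x /=.
apply/rowP => j; rewrite FE !mxE; congr (_ + _).
by apply: eq_bigr => k _; rewrite mxE.
Qed.

Lemma computed_square q :
  computed (fun x : 'rV[R]_q => map_mx square x).
Proof.
exists (NetLayer 1%:M 0 (NetAffine 1%:M 0)) => x /=.
by rewrite !mulmx1 !addr0.
Qed.

(** There is no activation after the last affine map of a network, so it merges with the first
    affine map of the next one. *)
Lemma computed_comp p q r (F : 'rV[R]_p -> 'rV[R]_q)
    (G : 'rV[R]_q -> 'rV[R]_r) :
  computed F -> computed G -> computed (fun x => G (F x)).
Proof.
move=> [N NF] [M MG].
suff [L LE] : exists L : network R p r,
    forall x, network_eval square L x =
      network_eval square M (network_eval square N x).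
  by exists L => x; rewrite LE NF MG.
elim: N M {F NF G MG} => {p q} [p q W b M|p q s W b N IH M].
  case: M W b => [q' r' W' b'|q' r' s' W' b' M] W b.
    exists (NetAffine (W *m W') (b *m W' + b')) => x /=.
    by rewrite mulmxDl mulmxA addrA.
  exists (NetLayer (W *m W') (b *m W' + b') M) => x /=.
  by rewrite mulmxDl mulmxA addrA.
have [L LE] := IH M.
by exists (NetLayer W b L) => x /=; rewrite LE.
Qed.

(* Polarization: products and the identity are affine in squares of affine
   maps. *)
Lemma computed_mul q (i j : 'I_q) :
  computed (fun y : 'rV[R]_q => row_mx y (const_mx (y 0 i * y 0 j) : 'rV_1)).
Proof.
pose A (y : 'rV[R]_q) : 'rV[R]_(q + q + 1) :=
  row_mx (row_mx y (\row_k (y 0 k + 1))) (const_mx (y 0 i + y 0 j)).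
pose B (u : 'rV[R]_(q + q + 1)) : 'rV[R]_(q + 1) :=
  row_mx
   (\row_k (2^-1 * (u 0 (lshift 1 (rshift q k))
      - u 0 (lshift 1 (lshift q k)) - 1)))
   (const_mx (2^-1 * (u 0 (rshift (q + q) 0)
      - u 0 (lshift 1 (lshift q i)) - u 0 (lshift 1 (lshift q j))))).
have cA : computed A.
  apply: computed_affine => k.
  case: (fintype.split_ordP k) => [{}k ->|{}k ->]; last first.
    under eq_fun do rewrite row_mxEr mxE.
    by apply: affine_add; exact: affine_coord.
  under eq_fun do rewrite row_mxEl.
  case: (fintype.split_ordP k) => [{}k ->|{}k ->].
    by under eq_fun do rewrite row_mxEl; exact: affine_coord.
  under eq_fun do rewrite row_mxEr mxE.
  by apply: affine_add; [exact: affine_coord|exact: affine_cst].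
have cB : computed B.
  apply: computed_affine => k.
  case: (fintype.split_ordP k) => [{}k ->|{}k ->].
    under eq_fun do rewrite row_mxEl mxE.
    by apply: affine_scale; do !apply: affine_add;
      (try apply: affine_opp); exact: affine_coord || exact: affine_cst.
  under eq_fun do rewrite row_mxEr mxE.
  by apply: affine_scale; do !apply: affine_add;
    (try apply: affine_opp); exact: affine_coord.
rewrite (_ : (fun y => _) = fun y => B (map_mx square (A y))).
  by do !apply: computed_comp => //; exact: computed_square.
apply/funext => y; apply/rowP => k.
case: (fintype.split_ordP k) => [{}k ->|{}k ->].
  rewrite /B 2!row_mxEl [RHS]mxE ![map_mx _ _ _ _]mxE /A !row_mxEl row_mxEr.
  by rewrite mxE /square; field.
rewrite /B 2!row_mxEr 2!mxE ![map_mx _ _ _ _]mxE /A !row_mxEl row_mxEr mxE.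
by rewrite /square; field.
Qed.

(* [F] must keep the inputs readable: networks have no parallel composition,
   so values are appended one at a time. *)
Lemma computed_extend p (g : 'rV[R]_p -> R) :
  polynomial_in (@coordinate p) g ->
  forall q (F : 'rV[R]_p -> 'rV[R]_q), computed F ->
  (forall j, exists k, forall x, F x 0 k = x 0 j) ->
  computed (fun x => row_mx (F x) (const_mx (g x) : 'rV_1)).
Proof.
have keep q (F : 'rV[R]_p -> 'rV[R]_q) (g' : 'rV[R]_p -> R) :
    (forall j, exists k, forall x, F x 0 k = x 0 j) ->
    (forall j, exists k, forall x,
      (row_mx (F x) (const_mx (g' x) : 'rV_1)) 0 k = x 0 j).
  by move=> cF j; have [k kE] := cF j; exists (lshift 1 k) => x; rewrite row_mxEl.
elim=> {g} [j|c|g h _ Pg _ Ph|g h _ Pg _ Ph] q F cF Fc.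
- have [k kE] := Fc j.
  pose A (y : 'rV[R]_q) : 'rV[R]_(q + 1) := row_mx y (const_mx (y 0 k)).
  rewrite (_ : (fun x => _) = fun x => A (F x)); last first.
    by apply/funext => x; rewrite /A kE.
  apply: computed_comp => //; apply: computed_affine => l.
  case: (fintype.split_ordP l) => [{}l ->|{}l ->].
    by under eq_fun do rewrite row_mxEl; exact: affine_coord.
  by under eq_fun do rewrite row_mxEr mxE; exact: affine_coord.
- pose A (y : 'rV[R]_q) : 'rV[R]_(q + 1) := row_mx y (const_mx c).
  apply: (computed_comp (G := A)) => //; apply: computed_affine => l.
  case: (fintype.split_ordP l) => [{}l ->|{}l ->].
    by under eq_fun do rewrite row_mxEl; exact: affine_coord.
  by under eq_fun do rewrite row_mxEr mxE; exact: affine_cst.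
- pose A (y : 'rV[R]_(q + 1 + 1)) : 'rV[R]_(q + 1) :=
    row_mx (\row_k y 0 (lshift 1 (lshift 1 k)))
      (const_mx (y 0 (lshift 1 (rshift q 0)) + y 0 (rshift (q + 1) 0))).
  have := Ph _ _ (Pg _ _ cF Fc) (keep _ _ _ Fc).
  move=> /(computed_comp (G := A)); rewrite (_ : (fun x => A _) =
    (fun x => row_mx (F x) (const_mx (g x + h x) : 'rV_1))); last first.
    apply/funext => x; congr row_mx.
      by apply/rowP => k; rewrite mxE !row_mxEl.
    by rewrite row_mxEr row_mxEl row_mxEr !const_mxE.
  apply; apply: computed_affine => l.
  case: (fintype.split_ordP l) => [{}l ->|{}l ->].
    by under eq_fun do rewrite row_mxEl mxE; exact: affine_coord.
  under eq_fun do rewrite row_mxEr mxE.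
  by apply: affine_add; exact: affine_coord.
- pose A (y : 'rV[R]_(q + 1 + 1 + 1)) : 'rV[R]_(q + 1) :=
    row_mx (\row_k y 0 (lshift 1 (lshift 1 (lshift 1 k))))
      (const_mx (y 0 (rshift (q + 1 + 1) 0))).
  have := Ph _ _ (Pg _ _ cF Fc) (keep _ _ _ Fc).
  have := @computed_mul (q + 1 + 1) (lshift 1 (rshift q 0)) (rshift (q + 1) 0).
  move=> /[swap] /computed_comp /[apply].
  move=> /(computed_comp (G := A)); rewrite (_ : (fun x => A _) =
    (fun x => row_mx (F x) (const_mx (g x * h x) : 'rV_1))); last first.
    apply/funext => x; congr row_mx.
      by apply/rowP => k; rewrite mxE !row_mxEl.
    by rewrite row_mxEr const_mxE row_mxEl !row_mxEr !const_mxE.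
  apply; apply: computed_affine => l.
  case: (fintype.split_ordP l) => [{}l ->|{}l ->].
    by under eq_fun do rewrite row_mxEl mxE; exact: affine_coord.
  by under eq_fun do rewrite row_mxEr mxE; exact: affine_coord.
Qed.

(** The induction on [q] keeps [x] in front of the values, as [computed_extend] needs the inputs
    readable; a final affine projection forgets them. *)
Lemma computed_polynomials p q (G : 'I_q -> 'rV[R]_p -> R) :
  (forall j, polynomial_in (@coordinate p) (G j)) ->
  computed (fun x => \row_j G j x).
Proof.
move=> PG.
pose proj n r (y : 'rV[R]_(n + r)) : 'rV[R]_r := rsubmx y.
have cH : computed (fun x => row_mx x (\row_j G j x)).
  elim: q G PG => [|q IH] G PG.
    apply: computed_affine => k.
    case: (fintype.split_ordP k) => [{}k ->|[]//].
    by under eq_fun do rewrite row_mxEl; exact: affine_coord.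
  have := IH (fun j => G (widen_ord (leqnSn q) j)) (fun j => PG _).
  move=> /(computed_extend (PG ord_max)) cE.
  pose A (y : 'rV[R]_(p + q + 1)) : 'rV[R]_(p + q.+1) := row_mx
    (\row_k y 0 (lshift 1 (lshift q k)))
    (\row_k if unlift ord_max k is Some l then y 0 (lshift 1 (rshift p l))
            else y 0 (rshift (p + q) 0)).
  rewrite (_ : (fun x => _) = fun x => A (row_mx (row_mx x
      (\row_j G (widen_ord (leqnSn q) j) x)) (const_mx (G ord_max x)))).
    apply: computed_comp; first apply: cE.
      by move=> j; exists (lshift q j) => x; rewrite row_mxEl.
    apply: computed_affine => l.
    case: (fintype.split_ordP l) => [{}l ->|{}l ->].
      by under eq_fun do rewrite row_mxEl mxE; exact: affine_coord.
    under eq_fun do rewrite row_mxEr mxE.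
    by case: unliftP => *; exact: affine_coord.
  apply/funext => x; congr row_mx; apply/rowP => k.
    by rewrite mxE !row_mxEl.
  rewrite mxE [RHS]mxE; case: unliftP => [l ->|->].
    rewrite row_mxEl row_mxEr mxE; congr (G _ x).
    by apply/val_inj; rewrite /= /bump leqNgt ltn_ord.
  by rewrite row_mxEr mxE.
rewrite (_ : (fun x => _) = fun x => proj _ _ (row_mx x (\row_j G j x))).
  apply: computed_comp => //; apply: computed_affine => j.
  by under eq_fun do rewrite mxE; exact: affine_coord.
by apply/funext => x; rewrite /proj row_mxKr.
Qed.

End Networks.

(** * Operators with one hidden layer *)

Lemma cvg_mx (R : realType) (T : Type) (F : set_system T) {FF : Filter F} m n
    (M : T -> 'M[R]_(m, n)) (A : 'M[R]_(m, n)) :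
  (forall i j, (fun x => M x i j) @ F --> A i j) -> M @ F --> A.
Proof.
move=> MA; apply/cvg_ballP => e e0.
suff : \forall x \near F, forall ij : 'I_m * 'I_n,
    ball (A ij.1 ij.2) e (M x ij.1 ij.2).
  by apply: filterS => x Mx; split=> // i j; exact: (Mx (i, j)).
by apply: filter_forall => -[i j]; exact: (cvg_ball (MA i j)).
Qed.

(** The channels are indexed by [S + T]: those in [S] carry the lifted functions, those in [T]
    receive the integrals. The kernel only maps [S] to [T] and the weight matrix is 0, so after the
    layer the channels in [S] vanish and each channel in [T] holds the square of its bias plus its
    integral. *)
Lemma shallow_operator (R : realType) p q (S T : finType)
    (h : S -> 'rV[R]_(p + 1) -> R) (k : S -> T -> R -> R -> R) (b : T -> R)
    (G : 'I_q -> (T -> R) -> R) :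
    (0 < #|S|)%N ->
    (forall s, polynomial_in (@coordinate R (p + 1)) (h s)) ->
    (forall s t, continuous (fun z : R * R => k s t z.1 z.2)) ->
    (forall a, polynomial_in (fun t (y : T -> R) => y t) (G a)) ->
  exists N : neural_operator R p q, forall c x,
    neural_operator_eval N c x = \row_a G a (fun t =>
      (b t + \int[lebesgue_measure]_(y in `[0, 1])
         \sum_s h s (row_mx (c y) (const_mx y)) * k s t x y) ^+ 2).
Proof.
move=> S0 Ph Ck PG.
pose d := #|{: S + T}|.
have d0 : (0 < d)%N by rewrite /d card_sum ltn_addr.
pose H (i : 'I_d) := if enum_val i is inl s then h s else fun=> 0.
have [L LE] : computed (fun x => \row_i H i x).
  apply: computed_polynomials => i; rewrite /H.
  by case: (enum_val i) => // _; exact: polynomial_cst.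
pose Gd (a : 'I_q) (y : 'rV[R]_(d + 1)) :=
  G a (fun t => y 0 (lshift 1 (enum_rank (inr t : S + T)))).
have [Q QE] : computed (fun x => \row_a Gd a x).
  apply: computed_polynomials => a; rewrite /Gd.
  by apply: polynomial_comp (PG a) => t; exact: polynomial_var.
pose ker x y : 'M[R]_d := \matrix_(i, j)
  if (enum_val i, enum_val j) is (inl s, inr t) then k s t x y else 0.
have ker_cont :
    {within `[0, 1] `*` `[0, 1], continuous (fun z : R * R => ker z.1 z.2)}.
  apply: continuous_subspaceT => z; apply: cvg_mx => i j.
  rewrite /ker mxE; under eq_fun do rewrite mxE.
  case: (enum_val i) => [s|_]; last exact: cvg_cst.
  by case: (enum_val j) => [_|t]; [exact: cvg_cst|exact: Ck].
pose bia : 'rV[R]_d := \row_i if enum_val i is inr t then b t else 0.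
exists (NeuralOperator d0 (@smooth_square R) L
  (isT : 0 < size [:: HiddenLayer 0 bia ker_cont])%N Q) => c x.
rewrite /neural_operator_eval /= QE; apply/rowP => a; rewrite mxE [RHS]mxE.
rewrite /Gd; congr (G a _); apply/funext => t.
rewrite row_mxEl /hidden_eval /= mxE /square; congr (_ ^+ 2).
rewrite mxE [X in X + _]mxE [X in _ + X]mxE [X in X + _ + _]mxE.
rewrite big1 => [|i _]; last by rewrite mxE mulr0.
rewrite add0r mxE enum_rankK; congr (_ + _); apply: eq_Rintegral => y _.
rewrite mxE (reindex (@enum_rank (S + T)%type)) /=; last first.
  exact: onW_bij (@enum_rank_bij _).
rewrite big_sumType/= [X in _ + X]big1 ?addr0 => [|t' _]; last first.
  by rewrite LE mxE /H enum_rankK mul0r.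
by apply: eq_bigr => s _; rewrite LE mxE /H enum_rankK mxE !enum_rankK.
Qed.

(** * C^1 functions on the unit interval *)

Lemma continuous_row (R : realType) (T : topologicalType) n
    (g : 'I_n -> T -> R) :
  (forall j, continuous (g j)) -> continuous (fun x => \row_j g j x).
Proof.
move=> Cg x; apply: cvg_mx => i j; rewrite mxE.
by under eq_fun do rewrite mxE; exact: Cg.
Qed.

Section C1.
Context {R : realType}.

(** Makes limits of difference quotients unique, endpoints included. A step of length at most 1/2
    stays in the interval when taken towards the farther endpoint. *)
Lemma within01_proper (t : R) : t \in `[0, 1] ->
  ProperFilter (within (`[0, 1] : set R) t^').
Proof.
rewrite in_itv /= => /andP[t0 t1]; apply: Build_ProperFilter_ex => A.
rewrite /within /= => /nbhs_ballP[e /= e0 be].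
pose r := Num.min (e / 2) (2^-1 : R).
have r0 : 0 < r by rewrite lt_min; lra.
have re : r < e by rewrite /r gt_min; apply/orP; left; lra.
have r1 : r <= 2^-1 by rewrite /r ge_min lexx orbT.
have [tl|tg] := leP t 2^-1.
  exists (t + r); apply: be => /=.
  - by rewrite /ball /= opprD addrA subrr sub0r normrN gtr0_norm.
  - by apply/eqP; lra.
  - by rewrite in_itv /=; apply/andP; split; lra.
exists (t - r); apply: be => /=.
- by rewrite /ball /= opprB addrCA subrr addr0 gtr0_norm.
- by apply/eqP; lra.
- by rewrite in_itv /=; apply/andP; split; lra.
Qed.

Lemma quotients_within_continuous (V : normedModType R) (A : set R)
    (u : R -> V) (t : R) (l : V) : quotients_within A u t --> l ->
  u s @[s --> within A (nbhs t)] --> u t.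
Proof.
move=> ul.
have {ul} : u s @[s --> within A t^'] --> u t.
  have : (s - t) *: ((s - t)^-1 *: (u s - u t)) + u t
      @[s --> within A t^'] --> 0 *: l + u t.
    apply: cvgD; last exact: cvg_cst.
    apply: cvgZ => //; rewrite -[X in _ --> X](subrr t).
    apply: cvgB; last exact: cvg_cst.
    by apply: cvg_trans (cvg_within _) _; apply: cvg_within.
  rewrite scale0r add0r; apply: cvg_trans; apply: near_eq_cvg.
  rewrite /within /= near_withinE; near=> s => sA.
  have st : s - t != 0 by rewrite subr_eq0; near: s; exact: nbhs_dnbhs_neq.
  by rewrite scalerA divff// scale1r subrK.
move=> H W /[dup] Wt /H; rewrite /= /within /= !nbhs_simpl /=.
move=> /nbhs_ballP[e /= e0 be]; apply/nbhs_ballP; exists e => //= s es sA.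
have [->|st] := eqVneq s t; first exact: nbhs_singleton.
exact: be.
Unshelve. all: by end_near. Qed.

Lemma C1_continuous (V : normedModType R) (u : R -> V) :
  is_C1_01 u -> {within `[0, 1], continuous u}.
Proof.
move=> [du _]; apply/subspace_continuousP => t t01.
by have /cvg_ex[l] := du t t01; exact: quotients_within_continuous.
Qed.

(** Lets a derivative be exhibited instead of handling the [lim] in [derive01]; uniqueness of limits
    identifies the two on $[0,1]$. *)
Lemma is_C1_01P (V : normedModType R) (u d : R -> V) :
  (forall t, t \in `[0, 1] -> quotients_within `[0, 1] u t --> d t) ->
  {within `[0, 1], continuous d} -> is_C1_01 u.
Proof.
move=> ud dc; split=> [t /ud /cvgP//|].
apply: subspace_eq_continuous dc => t; rewrite inE => t01.
have PF := within01_proper (t01 : t \in `[0, 1]).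
by apply/esym/cvg_lim; [exact: norm_hausdorff|exact: ud].
Qed.

Lemma C1_derive (V : normedModType R) (u : R -> V) : is_C1_01 u ->
  (forall t, t \in `[0, 1] -> quotients_within `[0, 1] u t --> derive01 u t).
Proof. by move=> [du _] t /du. Qed.

Lemma C1_cst (V : normedModType R) (c : V) : is_C1_01 (fun=> c).
Proof.
apply: (@is_C1_01P _ _ (fun=> 0)); last exact: cst_continuous.
move=> t _; rewrite /quotients_within.
by under eq_fun do rewrite subrr scaler0; exact: cvg_cst.
Qed.

Lemma C1_add (V : normedModType R) (u v : R -> V) :
  is_C1_01 u -> is_C1_01 v -> is_C1_01 (fun s => u s + v s).
Proof.
move=> Cu Cv; apply: (@is_C1_01P _ _ (fun s => derive01 u s + derive01 v s)).
  move=> t t01; rewrite /quotients_within.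
  under eq_fun do rewrite opprD addrACA scalerDr.
  by apply: cvgD; exact: C1_derive.
by move=> t; apply: cvgD; [apply: Cu.2|apply: Cv.2].
Qed.

Lemma C1_scale (V : normedModType R) (u : R -> R^o) (v : R -> V) :
  is_C1_01 u -> is_C1_01 v -> is_C1_01 (fun s => u s *: v s).
Proof.
move=> Cu Cv; apply: (@is_C1_01P _ _
    (fun s => derive01 u s *: v s + u s *: derive01 v s)).
  move=> t t01; rewrite /quotients_within.
  have E s : (s - t)^-1 *: (u s *: v s - u t *: v t) =
     ((s - t)^-1 *: (u s - u t)) *: v s + u t *: ((s - t)^-1 *: (v s - v t)).
    rewrite -[(_ *: (u s - u t)) *: v s]scalerA.
    rewrite [u t *: (_ *: _)]scalerA [u t * _]mulrC -[_ *: (v s - v t)]scalerA.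
    by rewrite -scalerDr; congr (_ *: _); rewrite scalerBl scalerBr addrA subrK.
  under eq_fun do rewrite E.
  apply: cvgD; apply: cvgZ; try exact: C1_derive; last exact: cvg_cst.
  move=> W /(quotients_within_continuous (C1_derive Cv t01)).
  exact: nbhs_dnbhs.
move=> t; apply: cvgD; apply: cvgZ;
  [apply: Cu.2|apply: C1_continuous|apply: C1_continuous|apply: Cv.2] => //.
Qed.

Lemma C1_polynomial (X I : Type) (v : I -> X -> R) (u : R -> X) g :
  (forall i, is_C1_01 (fun s => v i (u s) : R^o)) -> polynomial_in v g ->
  is_C1_01 (fun s => g (u s) : R^o).
Proof.
move=> Cv; elim=> {g} [i|c|g h _ Cg _ Ch|g h _ Cg _ Ch].
- exact: Cv.
- exact: C1_cst.
- exact: C1_add.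
- exact: C1_scale.
Qed.

Lemma C1_row n (u : R -> 'rV[R]_n) :
  (forall j, is_C1_01 (fun s => u s 0 j : R^o)) -> is_C1_01 u.
Proof.
move=> Cu; apply: (@is_C1_01P _ _
    (fun s => \row_j derive01 (fun s => u s 0 j : R^o) s)).
  move=> t t01; apply: cvg_mx => i j; rewrite ord1 mxE.
  rewrite /quotients_within; under eq_fun do rewrite !mxE.
  exact: C1_derive.
by apply: continuous_row => j; case: (Cu j).
Qed.

Lemma C1_coord n (u : R -> 'rV[R]_n) (j : 'I_n) :
  is_C1_01 u -> is_C1_01 (fun s => u s 0 j : R^o).
Proof.
move=> Cu; apply: (@is_C1_01P _ _ (fun s => derive01 u s 0 j)).
  move=> t t01.
  have E : (fun s => (s - t)^-1 *: (u s 0 j - u t 0 j : R^o)) =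
      (fun M : 'rV[R]_n => M 0 j) \o (fun s => (s - t)^-1 *: (u s - u t)).
    by apply/funext => s /=; rewrite !mxE.
  rewrite /quotients_within E.
  apply: continuous_cvg; first exact: coord_continuous.
  exact: C1_derive.
case: Cu => _ Cd t.
exact: (continuous_comp (Cd t) (@coord_continuous _ _ _ 0 j _)).
Qed.

End C1.

(** * Lipschitz functions on bounded sets *)

(* The library's [locally [lipschitz _ | _ in A]] speaks about neighbourhoods
   of all the points of [A `*` A], not only of the diagonal ones, so a covering
   argument on [C `*` C] suffices. *)
Lemma lipschitz_on_compact (R : realType) (V W : normedModType R) (F : V -> W)
    (C : set V) : compact C -> [locally [lipschitz (F z) | z in [set: V]]] ->
  exists2 L, 0 < L &
    forall x y, C x -> C y -> `|F x - F y| <= L * `|x - y|.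
Proof.
move=> cC lF.
have /compact_near_coveringP ncC := compact_setX cC cC.
pose P (L : R) (z : V * V) := `|F z.1 - F z.2| <= L * `|z.1 - z.2|.
have : \forall L \near +oo, C `*` C `<=` P L.
  apply: ncC => z _.
  have /(_ (conj I I)) := lF z; rewrite /lipschitz_on => /pinfty_ex_gt0[M M0 HM].
  exists ([set z' | P M z'], [set L | M <= L]) => /=.
    split; last by apply: nbhs_pinfty_ge; exact: num_real.
    move: HM; rewrite /dominated_by /within /=.
    by apply: filterS => z'; apply.
  move=> [z' L] /= [Pz ML]; apply: le_trans Pz _.
  exact: ler_wpM2r.
move=> /pinfty_ex_gt0[L L0 HL]; exists L => // x y Cx Cy.
exact: (HL (x, y)).
Qed.

Lemma ler_coord_norm (R : realType) n (x : 'rV[R]_n) j : `|x 0 j| <= `|x|.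
Proof.
rewrite [leRHS]/Num.Def.normr/= mx_normrE.
by apply/bigmax_geP; right => /=; exists (0, j).
Qed.

Lemma ler_row_norm (R : realType) n (x : 'rV[R]_n) c : 0 <= c ->
  (forall j, `|x 0 j| <= c) -> `|x| <= c.
Proof.
move=> c0 xc; rewrite [leLHS]/Num.Def.normr/= mx_normrE.
by apply/bigmax_leP; split=> // -[i j] _; rewrite /= ord1.
Qed.

Lemma compact_ball (R : realType) n (M : R) :
  compact [set x : 'rV[R]_n | `|x| <= M].
Proof.
apply: bounded_closed_compact.
  exists M; split; first exact: num_real.
  by move=> N MN x /= xM; apply: le_trans xM _; exact: ltW.
apply: (@closed_comp _ _ (fun x : 'rV[R]_n => `|x|) [set r | r <= M]).
  by move=> x _; exact: norm_continuous.
exact: closed_le.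
Qed.

(** Mean value theorem along the segment from [y] to [x], which stays in the ball by convexity. The
    derivative along [x - y] is a combination of the partial derivatives, and these are bounded on
    the compact ball. *)
Lemma lipschitz_C1 (R : realType) n (k : 'rV[R]_n -> R) (M : R) :
  C1_on_space k -> exists2 L, 0 < L & forall x y, `|x| <= M -> `|y| <= M ->
    `|k x - k y| <= L * `|x - y|.
Proof.
move=> [dk Dk].
have bD (v : 'rV[R]_n) :
    exists2 c, 0 <= c & forall x, `|x| <= M -> `|'D_v k x| <= c.
  have cD : {within [set x : 'rV[R]_n | `|x| <= M],
      continuous (fun x => 'D_v k x : R^o)}.
    by apply: continuous_subspaceT => x; exact: Dk.
  have /compact_bounded[c [_ Hc]] := continuous_compact cD (@compact_ball R n M).
  exists (`|c| + 1) => [|x xM]; first by rewrite addr_ge0.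
  apply: (Hc (`|c| + 1)); last by exists x.
  by rewrite (le_lt_trans (ler_norm c))// ltrDl.
have [c Hc0 Hc] : exists2 c : 'I_n -> R, (forall j, 0 <= c j) &
    forall j x, `|x| <= M -> `|'D_(delta_mx 0 j) k x| <= c j.
  have /choice[c Hc] : forall j : 'I_n, exists c, 0 <= c /\
      forall x, `|x| <= M -> `|'D_(delta_mx 0 j) k x| <= c.
    by move=> j; have [c c0 Hc] := bD (delta_mx 0 j); exists c.
  by exists c => j; case: (Hc j).
exists (\sum_j c j + 1); first by rewrite ltr_wpDl// sumr_ge0.
move=> x y xM yM; set v := x - y.
have dline (t : R) : is_derive t 1 (fun t => k (y + t *: v)) ('D_v k (y + t *: v)).
  have E : (fun h => h^-1 *: (((fun t => k (y + t *: v)) \o shift t) (h *: 1)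
          - k (y + t *: v))) =
      (fun h => h^-1 *: ((k \o shift (y + t *: v)) (h *: v) - k (y + t *: v))).
    apply/funext => h /=; congr (_ *: (k _ - _)).
    by rewrite scalerDl addrCA /GRing.scale/= mulr1.
  have dv : derivable k (y + t *: v) v by exact: diff_derivable.
  by apply: DeriveDef; [rewrite /derivable E|rewrite /derive E].
have lc : {within `[0, 1], continuous (fun t => k (y + t *: v))}.
  apply: continuous_subspaceT => t; apply: differentiable_continuous.
  by apply/derivable1_diffP; case: (dline t).
have [t] := MVT_segment (@ler01 R) (fun t _ => dline t) lc.
rewrite in_itv /= => /andP[t0 t1].
rewrite scale1r scale0r addr0 subr0 mulr1 (_ : y + v = x); last first.
  by rewrite /v addrC subrK.
move=> ->.
have zM : `|y + t *: v| <= M.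
  rewrite (_ : y + t *: v = (1 - t) *: y + t *: x); last first.
    by rewrite /v scalerBr scalerBl scale1r addrCA addrC.
  rewrite (le_trans (ler_normD _ _))// !normrZ !ger0_norm ?subr_ge0//.
  rewrite [leRHS](_ : M = (1 - t) * M + t * M); last by ring.
  by rewrite lerD// ler_wpM2l ?subr_ge0.
rewrite deriveE// [X in 'd _ _ X]row_sum_delta linear_sum/=.
rewrite (le_trans (ler_norm_sum _ _ _))// mulrDl mul1r ler_wpDr// mulr_suml.
apply: ler_sum => j _; rewrite linearZ/= normrM mulrC.
by rewrite -deriveE// ler_pM// ?Hc// ler_coord_norm.
Qed.

(** * Gronwall's inequality and stability of integral equations *)

Section Gronwall.
Context {R : realType}.
Local Notation mu := (@lebesgue_measure R).

Lemma continuous_integrable (f : R -> R) (a b : R) : continuous f ->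
  mu.-integrable `[a, b] (EFin \o f).
Proof.
move=> Cf; apply: continuous_compact_integrable; first exact: segment_compact.
exact: continuous_subspaceT.
Qed.

Lemma Rintegral_expR (c s : R) : c != 0 -> 0 <= s ->
  \int[mu]_(t in `[0, s]) expR (c * t) = (expR (c * s) - 1) / c.
Proof.
move=> c0; rewrite le_eqVlt => /predU1P[<-|s0].
  by rewrite set_itv1 Rintegral_set1 mulr0 expR0 subrr mul0r.
have dF (t : R) : is_derive t 1 (fun t => expR (c * t) / c) (expR (c * t)).
  have -> : (fun t : R => expR (c * t) / c) = c^-1 \*: (expR \o ( *%R c)).
    by apply/funext => x; rewrite /= mulrC.
  apply: is_derive_eq.
  by rewrite /GRing.scale/= mulr1 mulrCA mulVf// mulr1.
have CF : continuous (fun t : R => expR (c * t) / c).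
  move=> t; apply: differentiable_continuous.
  by apply/derivable1_diffP; case: (dF t).
have Ce : continuous (fun t : R => expR (c * t)).
  move=> t; apply: continuous_comp; last exact: continuous_expR.
  by apply: mulrl_continuous.
rewrite /Rintegral (@continuous_FTC2 _ _ (fun t => expR (c * t) / c))//=.
- by rewrite mulr0 expR0 mulrBl.
- exact: continuous_subspaceT.
- split; last 2 first.
  + by apply: cvg_at_right_filter; exact: CF.
  + by apply: cvg_at_left_filter; exact: CF.
  by move=> t _; case: (dF t).
- by move=> t _; rewrite derive1E; case: (dF t).
Qed.

Lemma gronwall (e : R -> R) (a L s0 : R) : continuous e ->
    (forall t, 0 <= e t) -> 0 <= a -> 0 < L -> 0 <= s0 <= 1 ->
    (forall s, 0 <= s <= s0 -> e s <= a + L * \int[mu]_(t in `[0, s]) e t) ->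
  e s0 <= 2 * a * expR (2 * L).
Proof.
move=> Ce e0 a0 L0 /andP[s00 s01] He.
(* The weight [expR (- 2 L t)] absorbs half of the integral term. *)
have Cw : continuous (fun t => e t * expR (- (2 * L) * t)).
  move=> t; apply: cvgM; first exact: Ce.
  apply: continuous_comp; last exact: continuous_expR.
  exact: mulrl_continuous.
have [s] := EVT_max s00 (continuous_subspaceT Cw).
rewrite in_itv /= => /andP[s_ge0 ss0] wmax.
set W := e s * _ in wmax.
have W0 : 0 <= W by rewrite mulr_ge0// expR_ge0.
have eW t : 0 <= t <= s0 -> e t <= W * expR (2 * L * t).
  move=> tI; have /wmax eW : t \in `[0, s0] by rewrite in_itv.
  rewrite -(ler_pM2r (expR_gt0 (- (2 * L) * t))) -[leRHS]mulrA -expRD.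
  by rewrite [X in expR (_ + X)]mulNr addrN expR0 mulr1.
have CW : continuous (fun t => W * expR (2 * L * t)).
  move=> t; apply: cvgM; first exact: cvg_cst.
  apply: continuous_comp; last exact: continuous_expR.
  exact: mulrl_continuous.
(* At the maximum point [s], integrating [eW] gives $e(s)\le a+\frac W2(e^{2Ls}-1)$; multiplying by
   $e^{-2Ls}$ yields $W\le a+W/2$. *)
have W2 : W <= 2 * a.
  have ints : \int[mu]_(t in `[0, s]) e t <= W * ((expR (2 * L * s) - 1) / (2 * L)).
    rewrite -Rintegral_expR ?mulf_neq0 ?gt_eqF// -RintegralZl//; last first.
      apply: continuous_integrable => t.
      apply: continuous_comp; last exact: continuous_expR.
      exact: mulrl_continuous.
    apply: le_Rintegral => //; try exact: continuous_integrable.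
    move=> t /=; rewrite in_itv /= => /andP[t0 ts].
    by apply: eW; rewrite t0 (le_trans ts).
  have := He s; rewrite s_ge0 ss0 => /(_ isT) es.
  have {es ints} : e s <= a + W / 2 * (expR (2 * L * s) - 1).
    apply: le_trans es _; rewrite lerD2l.
    rewrite -(ler_pM2l L0) in ints; apply: le_trans ints _.
    rewrite le_eqVlt; apply/orP; left; apply/eqP; field.
    by rewrite gt_eqF.
  have E0 := expR_gt0 (- (2 * L) * s).
  rewrite -(ler_pM2r E0) -/W => WE.
  have EE : expR (2 * L * s) * expR (- (2 * L) * s) = 1.
    by rewrite -expRD mulNr addrN expR0.
  have E1 : expR (- (2 * L) * s) <= 1.
    by rewrite -expR0 ler_expR mulNr oppr_le0 !mulr_ge0// ltW.
  have {}WE : W <= a * expR (- (2 * L) * s) + W / 2 * (1 - expR (- (2 * L) * s)).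
    apply: le_trans WE _; rewrite mulrDl -(mulrA (W / 2)).
    by rewrite [(_ - 1) * _]mulrBl EE mul1r.
  have : a * expR (- (2 * L) * s) <= a by rewrite ler_piMr.
  have : W / 2 * (1 - expR (- (2 * L) * s)) <= W / 2.
    by rewrite ler_piMr ?divr_ge0// gerBl ltW.
  lra.
apply: le_trans (eW s0 _) _; first by rewrite s00 lexx.
apply: ler_pM; rewrite ?expR_ge0//.
by rewrite ler_expR ler_piMr// mulr_ge0// ltW.
Qed.

(* The integral inequality is only available while [e] stays below [eps], as the
   vector field is only locally Lipschitz: consider the first time at which [e]
   reaches [eps]. *)
Lemma gronwall_local (e : R -> R) (a L eps : R) : continuous e ->
    (forall t, 0 <= e t) -> 0 <= a -> 0 < L -> e 0 <= a ->
    2 * a * expR (2 * L) < eps ->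
    (forall s0, 0 <= s0 <= 1 -> (forall t, 0 <= t <= s0 -> e t <= eps) ->
      forall s, 0 <= s <= s0 -> e s <= a + L * \int[mu]_(t in `[0, s]) e t) ->
  forall s, 0 <= s <= 1 -> e s <= eps.
Proof.
move=> Ce e0 a0 L0 ea aeps He s1 /andP[s10 s11]; rewrite leNgt; apply/negP => es1.
have aE : a <= 2 * a * expR (2 * L).
  have : 1 <= expR (2 * L) by rewrite -expR0 ler_expR mulr_ge0// ltW.
  by move=> E1; rewrite mulrC mulrA -[leLHS]mul1r ler_pM//; lra.
pose A := `[0, s1] `&` e @^-1` [set eps].
have cA : compact A.
  apply: (@subclosed_compact _ _ `[0, s1]); last by move=> ? [].
    apply: closedI; first exact: interval_closed.
    by apply: closed_comp => [x _|]; [exact: Ce|exact: closed_eq].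
  exact: segment_compact.
have hit s : 0 <= s -> eps <= e s -> exists2 c, 0 <= c <= s & e c = eps.
  move=> s_ge0 es.
  have [|c] := @IVT _ e 0 s eps s_ge0 (continuous_subspaceT Ce).
    by rewrite ge_min le_max es orbT (le_trans ea)// (le_trans aE)// ltW.
  by rewrite in_itv; exists c.
have A0 : A !=set0.
  have [c cI ec] := hit _ s10 (ltW es1).
  by exists c; split; rewrite /= ?in_itv.
(* The first hitting time is the minimum of the identity on the compact set [A]. *)
have [s0 + s0min] := compact_EVT_min A0 cA
  (@continuous_subspaceT _ _ _ (fun x : R => x) (fun x => cvg_id)).
rewrite inE => -[/=]; rewrite in_itv /= => /andP[s00 s0s1] es0.
have s0I : 0 <= s0 <= 1 by rewrite s00 (le_trans s0s1).
have below t : 0 <= t <= s0 -> e t <= eps.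
  move=> /andP[t0 ts0]; rewrite leNgt; apply/negP => et.
  have [c /andP[c0 ct] ec] := hit _ t0 (ltW et).
  have /s0min s0c : c \in A.
    by rewrite inE; split; rewrite /= ?in_itv/= ?c0 ?(le_trans ct)// (le_trans ts0).
  have ts0' : t = s0 by apply/le_anti; rewrite ts0 (le_trans s0c).
  by move: et; rewrite ts0' es0 ltxx.
have := gronwall Ce e0 a0 L0 s0I (He _ s0I below).
by rewrite es0 leNgt aeps.
Qed.

End Gronwall.

(** * Continuous dependence of integral equations on their data *)

Section Stability.
Context {R : realType}.
Local Notation mu := (@lebesgue_measure R).

Definition lipschitz_on_balls n r (G : 'rV[R]_n -> 'rV[R]_r -> 'rV[R]_n) :=
  forall M, exists2 L, 0 < L & forall x x' u u',
    `|x| <= M -> `|x'| <= M -> `|u| <= M -> `|u'| <= M ->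
    `|G x u - G x' u'| <= L * (`|x - x'| + `|u - u'|).

Definition integral_solution n r (G : 'rV[R]_n -> 'rV[R]_r -> 'rV[R]_n)
    (X : 'rV[R]_n) (phi : R) (u : R -> 'rV[R]_r) (p : R -> 'rV[R]_n) :=
  forall s, 0 <= s <= 1 ->
    p s = X + phi *: \row_j \int[mu]_(t in `[0, s]) G (p t) (u t) 0 j.

Lemma lipschitz_on_balls_continuous n r
    (G : 'rV[R]_n -> 'rV[R]_r -> 'rV[R]_n)
    (u : R -> 'rV[R]_r) (p : R -> 'rV[R]_n) :
  lipschitz_on_balls G -> continuous p -> continuous u ->
  continuous (fun t => G (p t) (u t)).
Proof.
move=> lG Cp Cu t0; have [L L0 HL] := lG (`|p t0| + `|u t0| + 1).
apply/cvgrPdist_le => e e0.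
have d0 : 0 < Num.min 1 (e / (2 * L)).
  by rewrite lt_min ltr01 divr_gt0// mulr_gt0.
near=> t.
have pt : `|p t0 - p t| <= Num.min 1 (e / (2 * L)).
  by near: t; move/cvgrPdist_le : (Cp t0); apply.
have ut : `|u t0 - u t| <= Num.min 1 (e / (2 * L)).
  by near: t; move/cvgrPdist_le : (Cu t0); apply.
move: pt ut; rewrite !le_min => /andP[p1 pe] /andP[u1 ue].
have ptM : `|p t| <= `|p t0| + 1.
  by rewrite -[p t](subrK (p t0)) addrC (le_trans (ler_normD _ _))// lerD2l distrC.
have utM : `|u t| <= `|u t0| + 1.
  by rewrite -[u t](subrK (u t0)) addrC (le_trans (ler_normD _ _))// lerD2l distrC.
have p00 := normr_ge0 (p t0); have u00 := normr_ge0 (u t0).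
apply: le_trans (HL _ _ _ _ _ _ _ _) _; try lra.
rewrite -ler_pdivlMl// mulrC.
apply: le_trans (lerD pe ue) _.
by rewrite le_eqVlt; apply/orP; left; apply/eqP; field; rewrite gt_eqF.
Unshelve. all: by end_near. Qed.

Lemma continuous_coord (T : topologicalType) n (g : T -> 'rV[R]_n) j :
  continuous g -> continuous (fun t => g t 0 j).
Proof.
by move=> Cg t; exact: (continuous_comp (Cg t) (@coord_continuous _ _ _ 0 j _)).
Qed.

Lemma norm_integral_row_le n (g : R -> 'rV[R]_n) (h : R -> R) (s : R) :
    continuous g -> continuous h -> (forall t, 0 <= t <= s -> `|g t| <= h t) ->
  `|\row_j \int[mu]_(t in `[0, s]) g t 0 j| <= \int[mu]_(t in `[0, s]) h t.
Proof.
move=> Cg Ch gh.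
have Cgj j : continuous (fun t => g t 0 j).
  exact: continuous_coord.
apply: ler_row_norm => [|j].
  apply: Rintegral_ge0 => t; rewrite /= in_itv /= => /gh; exact: le_trans.
rewrite mxE; apply: le_trans (le_normr_Rintegral _ _) _ => //.
  exact: continuous_integrable.
apply: le_Rintegral => //.
- apply: continuous_integrable => t.
  by apply: cvg_norm; exact: Cgj.
- exact: continuous_integrable.
- move=> t; rewrite /= in_itv /= => /gh; apply: le_trans.
  exact: ler_coord_norm.
Qed.

Lemma Rintegral_subset_le (h : R -> R) (s : R) : continuous h ->
    (forall t, 0 <= h t) -> s <= 1 ->
  \int[mu]_(t in `[0, s]) h t <= \int[mu]_(t in `[0, 1]) h t.
Proof.
move=> Ch h0 s1; rewrite /Rintegral fine_le//.
- exact: integrable_fin_num (continuous_integrable _ _ Ch).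
- exact: integrable_fin_num (continuous_integrable _ _ Ch).
apply: ge0_subset_integral => //.
- exact: (measurable_int mu (continuous_integrable _ _ Ch)).
- by move=> t _; rewrite lee_fin.
- by apply: subset_itvl; rewrite bnd_simp.
Qed.

(** The inputs are compared in $L^1$ only, since they enter under the integral. [delta] is fixed
    before [p']: it depends on the reference solution and on the bounds [M] and [Phi]. *)
Lemma integral_solution_stable n r (G : 'rV[R]_n -> 'rV[R]_r -> 'rV[R]_n)
    (M Phi : R) (X : 'rV[R]_n) (phi : R) (u : R -> 'rV[R]_r)
    (p : R -> 'rV[R]_n) :
    lipschitz_on_balls G -> 0 < Phi ->
    continuous p -> continuous u -> (forall t, `|u t| <= M) ->
    integral_solution G X phi u p ->
  forall eps, 0 < eps -> exists2 delta, 0 < delta &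
    forall X' phi' u' p', continuous p' -> continuous u' ->
      (forall t, `|u' t| <= M) -> 0 <= phi' <= Phi ->
      integral_solution G X' phi' u' p' ->
      `|X' - X| <= delta -> `|phi' - phi| <= delta ->
      \int[mu]_(t in `[0, 1]) `|u' t - u t| <= delta ->
    forall s, 0 <= s <= 1 -> `|p' s - p s| <= eps.
Proof.
move=> lG Phi0 Cp Cu uM psol eps eps0.
have Cnorm k (v : R -> 'rV[R]_k) : continuous v -> continuous (fun t => `|v t|).
  by move=> Cv t; apply: cvg_norm; exact: Cv.
have [t1 _ pmax] := EVT_max (@ler01 R) (continuous_subspaceT (Cnorm _ _ Cp)).
have CG := lipschitz_on_balls_continuous lG Cp Cu.
have [t2 _ Gmax] := EVT_max (@ler01 R) (continuous_subspaceT (Cnorm _ _ CG)).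
set Mp := `|p t1| in pmax; set B := `|G _ _| in Gmax.
(* This ball contains the inputs, the reference trajectory and every point at distance at most 1
   from it; hence the cap at 1 in [eps1]. *)
have [L L0 HL] := lG (`|M| + Mp + 1).
pose eps1 := Num.min eps 1.
have eps10 : 0 < eps1 by rewrite lt_min eps0 ltr01.
pose Lam := Phi * L; have Lam0 : 0 < Lam by rewrite mulr_gt0.
(* The three terms account for the errors in [X], in [phi] and in the inputs. With the [delta]
   below, the Gronwall bound [2 * (delta * C) * expR (2 * Lam)] equals [eps1 / 2]. *)
pose C := 1 + B + Lam.
have C0 : 0 < C by rewrite /C -addrA ltr_wpDr// addr_ge0// ?normr_ge0// ltW.
have E0 := expR_gt0 (2 * Lam).
pose delta := eps1 / (4 * C * expR (2 * Lam)).
have delta0 : 0 < delta by rewrite divr_gt0// !mulr_gt0.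
exists delta => // X' phi' u' p' Cp' Cu' u'M /andP[phi'0 phi'Phi] p'sol dX dphi du.
have Ce : continuous (fun t => `|p' t - p t|).
  by apply: Cnorm => t; apply: cvgB; [exact: Cp'|exact: Cp].
have Cd : continuous (fun t => `|u' t - u t|).
  by apply: Cnorm => t; apply: cvgB; [exact: Cu'|exact: Cu].
have CG' := lipschitz_on_balls_continuous lG Cp' Cu'.
suff H : forall s, 0 <= s <= 1 -> `|p' s - p s| <= eps1.
  by move=> s sI; apply: le_trans (H _ sI) _; rewrite ge_min lexx.
apply: (@gronwall_local _ (fun t => `|p' t - p t|) (delta * C) Lam) => //.
- by rewrite mulr_ge0// ltW.
- rewrite psol ?lexx ?ler01// p'sol ?lexx ?ler01//.
  have row0 (g : R -> 'rV[R]_n) : \row_j \int[mu]_(t in `[0, 0]) g t 0 j = 0.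
    by apply/rowP => j; rewrite !mxE set_itv1 Rintegral_set1.
  rewrite (row0 (fun t => G (p t) (u t))) (row0 (fun t => G (p' t) (u' t))).
  rewrite !scaler0 !addr0 (le_trans dX)// ler_peMr//; first exact: ltW.
  by rewrite /C -addrA lerDl addr_ge0// ?normr_ge0// ltW.
- rewrite /delta.
  have -> : 2 * (eps1 / (4 * C * expR (2 * Lam)) * C) * expR (2 * Lam) = eps1 / 2.
    by field; rewrite !gt_eqF.
  by rewrite ltr_pdivrMr// ltr_pMr// ltr1n.
move=> s0 /andP[s00 s01] below s /andP[s_ge0 ss0].
have s1 : s <= 1 by exact: le_trans ss0 s01.
rewrite psol ?s_ge0// p'sol ?s_ge0//.
set I' := \row_j _; set I := \row_j _.
(* Split so that [phi' - phi] multiplies the reference integral [I], which is bounded by [B]; [phi']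
   is bounded by [Phi]. *)
have -> : X' + phi' *: I' - (X + phi *: I) =
    (X' - X) + phi' *: (I' - I) + (phi' - phi) *: I.
  by rewrite scalerBr scalerBl; apply/rowP => j; rewrite !mxE; ring.
have II : I' - I = \row_j \int[mu]_(t in `[0, s])
    (G (p' t) (u' t) - G (p t) (u t)) 0 j.
  apply/rowP => j; rewrite !mxE -RintegralB//.
  - by apply: eq_Rintegral => t _; rewrite !mxE.
  - by apply: continuous_integrable; exact: (continuous_coord CG').
  - by apply: continuous_integrable; exact: (continuous_coord CG).
have pM t : 0 <= t <= s -> `|p t| <= Mp.
  by move=> /andP[t0 ts]; apply: pmax; rewrite in_itv /= t0 (le_trans ts).
have IB : `|I| <= B.
  have : `|I| <= \int[mu]_(t in `[0, s]) B.
    apply: norm_integral_row_le.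
    - exact: CG.
    - by move=> t; exact: cvg_cst.
    - move=> t /andP[t0 ts].
      by apply: Gmax; rewrite in_itv /= t0 (le_trans ts).
  move/le_trans; apply.
  apply: le_trans (Rintegral_subset_le _ _ s1) _.
  - by move=> t; exact: cvg_cst.
  - by move=> _; exact: normr_ge0.
  by rewrite Rintegral_cst//= lebesgue_measure_itv/= lte01 oppr0 adde0 mulr1.
have IdI : `|I' - I| <= L * (\int[mu]_(t in `[0, s]) `|p' t - p t| + delta).
  rewrite II.
  have : `|\row_j \int[mu]_(t in `[0, s]) (G (p' t) (u' t) - G (p t) (u t)) 0 j|
      <= \int[mu]_(t in `[0, s]) (L * (`|p' t - p t| + `|u' t - u t|)).
    apply: norm_integral_row_le.
    - by move=> t; apply: cvgB; [exact: CG'|exact: CG].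
    - by move=> t; apply: cvgM; [exact: cvg_cst|apply: cvgD; [exact: Ce|exact: Cd]].
    move=> t tI; have /below et : 0 <= t <= s0.
      by case/andP: tI => -> /le_trans; apply.
    have Mp0 : 0 <= Mp by exact: normr_ge0.
    have M0 := normr_ge0 M; have MM := ler_norm M.
    have p't : `|p' t| <= Mp + 1.
      rewrite -[p' t](subrK (p t)) addrC (le_trans (ler_normD _ _))// lerD ?pM//.
      by apply: le_trans et _; rewrite /eps1 ge_min lexx orbT.
    have pt := pM _ tI.
    have MM' : M <= `|M| + Mp + 1 by lra.
    have [pM1 p'M1] : `|p t| <= `|M| + Mp + 1 /\ `|p' t| <= `|M| + Mp + 1 by lra.
    exact: HL p'M1 pM1 (le_trans (u'M t) MM') (le_trans (uM t) MM').
  move/le_trans; apply.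
  rewrite RintegralZl//; last first.
    by apply: continuous_integrable => t; apply: cvgD; [exact: Ce|exact: Cd].
  apply: ler_wpM2l; first exact: ltW.
  rewrite RintegralD//; try exact: continuous_integrable.
  rewrite lerD2l; apply: le_trans du; apply: Rintegral_subset_le => //.
set J := \int[mu]_(t in _) _ in IdI *.
rewrite (le_trans (ler_normD _ _))//.
have n1 : `|X' - X + phi' *: (I' - I)| <= delta + Phi * (L * (J + delta)).
  rewrite (le_trans (ler_normD _ _))// lerD// normrZ ger0_norm//.
  by rewrite ler_pM.
have n2 : `|(phi' - phi) *: I| <= delta * B by rewrite normrZ ler_pM.
apply: le_trans (lerD n1 n2) _.
rewrite le_eqVlt; apply/orP; left; apply/eqP; rewrite /C /Lam; ring.
Qed.

End Stability.

(** * Polynomial selection of centres *)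

(** Compactness in near-covering form, for the filter of finite sequences of points of [K] ordered
    by inclusion: near each [x] of [K], every sequence containing [x] covers. *)
Lemma compact_finite_cover (X : topologicalType) (K : set X)
    (O : X -> set X) : compact K -> (forall x, K x -> nbhs x (O x)) ->
  exists s : seq X, (forall x, x \in s -> K x) /\
    forall y, K y -> exists2 x, x \in s & O x y.
Proof.
move=> /compact_near_coveringP/near_covering_withinP cK KO.
pose F : set_system (seq X) := 
  filter_from [set s : seq X | forall x : X, x \in s -> K x]
  (fun s => [set s' : seq X | {subset s <= s'}]).
have FF : Filter F.
  apply: filter_from_filter; first by exists [::].
  move=> s t sK tK; exists (s ++ t).
    by move=> x; rewrite mem_cat => /orP[/sK|/tK].
  by move=> w stw; split=> x xs; apply: stw; rewrite mem_cat xs ?orbT.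
pose P (s : seq X) y := exists2 x, x \in s & O x y.
have [|s sK /(_ s) Ps] := cK (seq X) F P FF.
  move=> x Kx; exists (O x, [set s' : seq X | {subset [:: x] <= s'}]).
    split; first exact: KO.
    by exists [:: x] => // y; rewrite inE => /eqP->.
  move=> [y s] /= [Oxy xs] _; exists x => //.
  by apply: xs; rewrite mem_head.
by exists s; split=> // y Ky; exact: Ps.
Qed.

Lemma bernoulli_le (R : realType) (x : R) n : -1 <= x ->
  1 + n%:R * x <= (1 + x) ^+ n.
Proof.
move=> x1; elim: n => [|n IH]; first by rewrite mul0r addr0 expr0.
rewrite exprS; apply: (@le_trans _ _ ((1 + x) * (1 + n%:R * x))).
  rewrite -subr_ge0 -natr1.
  rewrite (_ : _ - _ = n%:R * x ^+ 2); last by ring.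
  by rewrite mulr_ge0// sqr_ge0.
by apply: ler_wpM2l => //; lra.
Qed.

(* The polynomial [(1 - x ^ n) ^ (k ^ n)] of Brosowski and Deutsch, rescaled:
   it is near 1 for [k x < 1] and near 0 for [k x > 1]. *)
Lemma selection_polynomial (R : realType) (B r eta : R) : 0 < r -> 0 < eta ->
  exists q : R -> R,
    (forall (X I : Type) (v : I -> X -> R) g, polynomial_in v g ->
       polynomial_in v (fun x => q (g x))) /\
    forall t, 0 <= t <= B -> [/\ 0 <= q t <= 1,
      t <= r / 4 -> 1 - eta <= q t & r <= t -> q t <= eta].
Proof.
move=> r0 eta0.
(* The maximum with [r] ensures [d <= 1], which keeps [k * d] below 2 after rounding up. *)
pose B' := Num.max B r.
have B'0 : 0 < B' by rewrite lt_max r0 orbT.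
pose d := r / B'.
have d0 : 0 < d by rewrite divr_gt0.
have d1 : d <= 1 by rewrite ler_pdivrMr// mul1r le_max lexx orbT.
(* With $1<kd\le2$ and $x=t/B'$, one gets $kx\le1/2$ when $t\le r/4$ and $kx\ge kd=1+\rho$ when
   $t\ge r$. *)
pose k := (Num.truncn d^-1).+1.
have /andP[k1 k2] : (Num.truncn d^-1)%:R <= d^-1 < k%:R.
  by apply: truncn_itv; rewrite invr_ge0 ltW.
have kd1 : 1 < k%:R * d by rewrite -ltr_pdivrMr// mul1r.
have kd2 : k%:R * d <= 2.
  have := k1; rewrite -(ler_pM2r d0) mulVf ?gt_eqF// => k1'.
  by rewrite /k -natr1 mulrDl mul1r; lra.
pose rho := k%:R * d - 1.
have rho0 : 0 < rho by rewrite subr_gt0.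
(* An exponent above both summands gives, by Bernoulli, $2^a\ge1/\eta$ and $(1+\rho)^a\ge1/\eta$,
   one for each side of the threshold. *)
pose A := eta^-1 + (eta * rho)^-1.
have A0 : 0 <= A by rewrite addr_ge0// invr_ge0 ltW// mulr_gt0.
pose a := (Num.truncn A).+1.
have aA : A < a%:R by have /andP[] := truncn_itv A0.
have a1 : eta^-1 <= a%:R.
  by apply: le_trans (ltW aA); rewrite lerDl invr_ge0 ltW// mulr_gt0.
have a2 : eta^-1 <= a%:R * rho.
  rewrite -ler_pdivrMr// -invfM; apply: le_trans (ltW aA).
  by rewrite lerDr invr_ge0 ltW.
exists (fun t => (1 - (t / B') ^+ a) ^+ (k ^ a)); split=> [X I v g Pg|t].
  apply: polynomial_exp; apply: polynomial_sub; first exact: polynomial_cst.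
  apply: polynomial_exp; apply: polynomial_mul => //; exact: polynomial_cst.
move=> /andP[t0 tB].
set x := t / B'; set y := x ^+ a.
have x0 : 0 <= x by rewrite divr_ge0// ltW.
have x1 : x <= 1 by rewrite ler_pdivrMr// mul1r le_max tB.
have y0 : 0 <= y by rewrite exprn_ge0.
have y1 : y <= 1 by rewrite exprn_ile1.
have Ny : (k ^ a)%:R * y = (k%:R * x) ^+ a by rewrite exprMn natrX.
split.
- by rewrite exprn_ge0 ?subr_ge0//= exprn_ile1 ?subr_ge0// gerBl.
- move=> tr.
  have kx : k%:R * x <= 2^-1.
    have : x <= d / 4.
      by rewrite /x /d mulrAC ler_pM2r ?invr_gt0.
    rewrite -(ler_pM2l (_ : 0 < k%:R :> R))// => /le_trans; apply.
    by rewrite mulrA; lra.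
  have := @bernoulli_le R (- y) (k ^ a); rewrite lerN2 => /(_ y1).
  apply: le_trans; rewrite mulrN Ny lerB//.
  have h2 : (0 : R) <= 2^-1 by lra.
  have h3 : 0 <= k%:R * x by exact: mulr_ge0.
  apply: le_trans (lerXn2r _ h3 h2 kx) _.
  rewrite exprVn -[leRHS]invrK lef_pV2 ?posrE ?invr_gt0 ?exprn_gt0//.
  apply: le_trans a1 _.
  have := @bernoulli_le R 1 a; rewrite mulr1 (_ : 1 + 1 = 2)// => H.
  by apply: le_trans (H _); lra.
- move=> rt.
  have kx : 1 + rho <= k%:R * x.
    rewrite /rho addrC subrK ler_pM2l ?ltr0n//.
    by rewrite /d /x ler_pM2r ?invr_gt0.
  have Ny_ge : eta^-1 <= (k ^ a)%:R * y.
    rewrite Ny; apply: (@le_trans _ _ ((1 + rho) ^+ a)); last first.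
      by rewrite lerXn2r// nnegrE; lra.
    have := @bernoulli_le R rho a; move=> H; apply: le_trans (H _); lra.
  (* With $N=k^a$: $(1-y)^N(1+Ny)\le(1-y)^N(1+y)^N=(1-y^2)^N\le1$, and $1+Ny\ge1/\eta$. *)
  have prod1 : (1 - y) ^+ (k ^ a) * (1 + (k ^ a)%:R * y) <= 1.
    apply: (@le_trans _ _ ((1 - y) ^+ (k ^ a) * (1 + y) ^+ (k ^ a))).
      apply: ler_wpM2l; first by rewrite exprn_ge0// subr_ge0.
      by apply: bernoulli_le; lra.
    rewrite -exprMn exprn_ile1//.
      by rewrite mulr_ge0; lra.
    by rewrite (_ : _ * _ = 1 - y ^+ 2); [rewrite gerBl sqr_ge0|ring].
  have q0 : 0 <= (1 - y) ^+ (k ^ a) by rewrite exprn_ge0// subr_ge0.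
  rewrite -(ler_pM2r (_ : 0 < eta^-1)) ?invr_gt0// mulfV ?gt_eqF//.
  apply: le_trans prod1; apply: ler_wpM2l => //; lra.
Qed.

(* Normalization-free weights: their sum telescopes to [1 - \prod_j (1 - q j)],
   which is near 1 as soon as one [q j] is. *)
Definition blend (R : realType) J (q : 'I_J -> R) (j : 'I_J) : R :=
  q j * \prod_(l < J | (l < j)%N) (1 - q l).

Lemma sum_blend (R : realType) J (q : 'I_J -> R) :
  \sum_j blend q j = 1 - \prod_j (1 - q j).
Proof.
elim: J q => [|J IH] q; first by rewrite !big_ord0 subrr.
rewrite big_ord_recr [in RHS]big_ord_recr/=.
have -> : \sum_(j < J) blend q (widen_ord (leqnSn J) j) =
    \sum_(j < J) blend (fun l => q (widen_ord (leqnSn J) l)) j.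
  apply: eq_bigr => j _; rewrite /blend; congr (_ * _).
  rewrite big_mkcond big_ord_recr/= ltnNge ltnW//= mulr1.
  by rewrite -big_mkcond.
have E : blend q ord_max =
    q ord_max * \prod_(l < J) (1 - q (widen_ord (leqnSn J) l)).
  rewrite /blend big_mkcond big_ord_recr/= ltnn mulr1; congr (_ * _).
  by apply: eq_bigr => l _; rewrite ltn_ord.
by rewrite IH E; ring.
Qed.

(** The weights miss 1 by $r=\prod_j(1-q_j)\le\eta$. A centre with a close value contributes [eps]
    times its weight; any other has weight at most [eta], against the crude bound [2 * M + eps]. The
    defect [r] and the [J] centres explain the factor [J%:R + 1]. *)
Lemma blend_error (R : realType) J (q v : 'I_J -> R) (V M eps eta : R) :
    (forall j, 0 <= q j <= 1) -> (exists j, 1 - eta <= q j) ->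
    (forall j, `|V - v j| <= eps \/ q j <= eta) ->
    (forall j, `|v j| <= M) -> `|V| <= M + eps -> 0 <= eps -> 0 <= eta ->
  `|V - \sum_j blend q j * v j| <= eps + eta * (J%:R + 1) * (2 * M + eps).
Proof.
move=> q01 [j0 qj0] near_or vM VM eps0 eta0.
have M0 : 0 <= M by apply: le_trans (vM j0).
have p01 (P : pred 'I_J) : 0 <= \prod_(l < J | P l) (1 - q l) <= 1.
  apply/andP; split.
    by apply: prodr_ge0 => l _; have := q01 l; lra.
  by apply: prodr_ile1 => l _; have := q01 l; lra.
have w0 j : 0 <= blend q j.
  by rewrite mulr_ge0//; [have := q01 j; lra|have := p01 (fun l => (l < j)%N); lra].
have wq j : blend q j <= q j.
  rewrite /blend ler_piMr//; first by have := q01 j; lra.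
  by have := p01 (fun l => (l < j)%N); lra.
pose r := \prod_j (1 - q j).
have r_eta : r <= eta.
  rewrite /r (bigD1 j0)//=.
  have := p01 (fun l => l != j0); have := q01 j0 => H1 H2.
  by rewrite -[leRHS]mulr1 ler_pM//; lra.
have r0 : 0 <= r by have := p01 predT; rewrite /r; lra.
have sw : \sum_j blend q j = 1 - r by exact: sum_blend.
have -> : V - \sum_j blend q j * v j = r * V + \sum_j blend q j * (V - v j).
  under [in RHS]eq_bigr do rewrite mulrBr.
  by rewrite sumrB -mulr_suml sw; ring.
apply: le_trans (ler_normD _ _) _.
have H1 : `|r * V| <= eta * (2 * M + eps).
  by rewrite normrM ger0_norm// ler_pM//; lra.
have H2 : `|\sum_j blend q j * (V - v j)| <=
    \sum_j (blend q j * eps + eta * (2 * M + eps)).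
  apply: le_trans (ler_norm_sum _ _ _) _; apply: ler_sum => j _.
  rewrite normrM ger0_norm//.
  have [Vv|qe] := near_or j.
    apply: ler_wpDr; first by rewrite mulr_ge0//; lra.
    exact: ler_wpM2l.
  apply: ler_wpDl; first exact: mulr_ge0.
  rewrite ler_pM// ?(le_trans (wq j))//.
  by apply: le_trans (ler_normB _ _) _; have := vM j; lra.
apply: le_trans (lerD H1 H2) _.
rewrite big_split/= -mulr_suml sw sumr_const card_ord.
rewrite -[X in _ + (_ + X)]mulr_natr.
have : 0 <= r * eps by exact: mulr_ge0.
nra.
Qed.

(** * The approximation theorem on a compact set of inputs *)

Section Clamp.
Context {R : realType}.

(** Retraction onto the interval: composing with it makes a function that is continuous within
    $[0,1]$ continuous on the whole line, as the kernels and the integral estimates require. *)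
Definition clamp (t : R) : R := Num.min (Num.max t 0) 1.

Lemma clamp_in (t : R) : clamp t \in `[0, 1].
Proof. by rewrite in_itv /= le_min le_max lexx orbT ler01 ge_min lexx orbT. Qed.

Lemma clamp_id (t : R) : t \in `[0, 1] -> clamp t = t.
Proof.
by rewrite in_itv /= => /andP[t0 t1]; rewrite /clamp max_l// min_l.
Qed.

Lemma clamp_continuous : continuous clamp.
Proof.
have -> : clamp = (id \max (fun=> 0) : R -> R^o) \min (fun=> 1) by [].
move=> t; apply: continuous_min; last exact: cvg_cst.
by apply: continuous_max; [exact: cvg_id|exact: cvg_cst].
Qed.

Lemma continuous_clamp (T : topologicalType) (u : R -> T) :
  {within `[0, 1], continuous u} -> continuous (fun t => u (clamp t)).
Proof.
move=> /subspace_continuousP Cu t W /(Cu _ (clamp_in t)).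
rewrite /= /within /= => /clamp_continuous H.
have {}H : \forall s \near t, clamp s \in `[0, 1] -> W (u (clamp s)) by exact: H.
suff : \forall s \near t, W (u (clamp s)) by exact.
by apply: filterS H => s; apply; exact: clamp_in.
Qed.

Lemma eq_C1 (V : normedModType R) (u v : R -> V) :
  (forall t, t \in `[0, 1] -> u t = v t) -> is_C1_01 u -> is_C1_01 v.
Proof.
move=> uv [du Cd].
have qS (u' v' : R -> V) t : t \in `[0, 1] ->
    (forall t, t \in `[0, 1] -> u' t = v' t) ->
    quotients_within `[0, 1] u' t `<=` quotients_within `[0, 1] v' t.
  move=> t01 uv' W H.
  have {}H : \forall s \near t^', s \in `[0, 1] ->
    W ((s - t)^-1 *: (u' s - u' t)) by exact: H.
  suff : \forall s \near t^', s \in `[0, 1] ->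
    W ((s - t)^-1 *: (v' s - v' t)) by exact.
  by apply: filterS H => s Ws s01; rewrite -!uv'//; exact: Ws.
have qE t : t \in `[0, 1] ->
    quotients_within `[0, 1] u t = quotients_within `[0, 1] v t.
  by move=> t01; apply/seteqP; split; apply: qS => // s /uv.
split=> [t t01|]; first by rewrite -qE//; exact: du.
apply: subspace_eq_continuous Cd => t; rewrite inE => t01.
exact: (congr1 (fun F => lim F) (qE t t01)).
Qed.

End Clamp.

Section Approximation.
Context {R : realType}.
Local Notation mu := (@lebesgue_measure R).

Definition sqdist p (c c' : R -> 'rV[R]_p) : R :=
  \int[mu]_(y in `[0, 1]) \sum_l (c y 0 l - c' y 0 l) ^+ 2.

Lemma sqdist_ge0 p (c c' : R -> 'rV[R]_p) : 0 <= sqdist c c'.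
Proof.
by apply: Rintegral_ge0 => y _; apply: sumr_ge0 => l _; exact: sqr_ge0.
Qed.

Lemma Rintegral01_cst (r : R) : \int[mu]_(y in `[0, 1]) r = r.
Proof.
by rewrite Rintegral_cst//= lebesgue_measure_itv/= lte01 oppr0 adde0 mulr1.
Qed.

Lemma continuous_sum (T : topologicalType) (I : Type) (s : seq I)
    (g : I -> T -> R) : (forall i, continuous (g i)) ->
  continuous (fun x => \sum_(i <- s) g i x).
Proof.
move=> Cg; elim: s => [|i s IH] x.
  by under eq_fun do rewrite big_nil; exact: cvg_cst.
under eq_fun do rewrite big_cons.
by apply: cvgD; [exact: Cg|exact: IH].
Qed.

(** The first integral depends on [c'] alone and becomes a bias; the second is linear in the lifted
    values of [c], with coefficients that a kernel can store. *)
Lemma sqdist_expand p (c c' : R -> 'rV[R]_p) : continuous c -> continuous c' ->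
  \int[mu]_(y in `[0, 1]) (\sum_l (c' y 0 l) ^+ 2) +
  \int[mu]_(y in `[0, 1])
    (\sum_l c y 0 l * (-2 * c' y 0 l) + \sum_l (c y 0 l) ^+ 2) = sqdist c c'.
Proof.
move=> Cc Cc'.
have Cj l := continuous_coord (j := l) Cc; have C'j l := continuous_coord (j := l) Cc'.
rewrite -RintegralD//.
- apply: eq_Rintegral => y _; rewrite -!big_split/=.
  by apply: eq_bigr => l _; ring.
- apply: continuous_integrable; apply: continuous_sum => l y.
  by under eq_fun do rewrite expr2; apply: cvgM; exact: C'j.
- apply: continuous_integrable => y; apply: cvgD; move: y;
    apply: continuous_sum => l y.
    by apply: cvgM; [exact: Cj|apply: cvgM; [exact: cvg_cst|exact: C'j]].
  by under eq_fun do rewrite expr2; apply: cvgM; exact: Cj.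
Qed.

Lemma sqdist_clamp p (c c' : R -> 'rV[R]_p) :
  sqdist (fun y => c (clamp y)) (fun y => c' (clamp y)) = sqdist c c'.
Proof.
by apply: eq_Rintegral => y; rewrite inE => y01; rewrite clamp_id.
Qed.

Lemma sqdist_le p (c c' : R -> 'rV[R]_p) b :
  {within `[0, 1], continuous c} -> {within `[0, 1], continuous c'} ->
  (forall y, y \in `[0, 1] -> \sum_l (c y 0 l - c' y 0 l) ^+ 2 <= b) ->
  sqdist c c' <= b.
Proof.
move=> /continuous_clamp Cc /continuous_clamp Cc' cb.
rewrite -(Rintegral01_cst b) -sqdist_clamp; apply: le_Rintegral => //.
- apply: continuous_integrable; apply: continuous_sum => l y.
  under eq_fun do rewrite expr2.
  by apply: cvgM; apply: cvgB; exact: continuous_coord.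
- by apply: continuous_integrable => y; exact: cvg_cst.
- by move=> y _; exact/cb/clamp_in.
Qed.

Lemma le_sqdist p (c c' : R -> 'rV[R]_p) (g : R -> R) :
  {within `[0, 1], continuous c} -> {within `[0, 1], continuous c'} ->
  continuous g ->
  (forall y, y \in `[0, 1] -> g y <= \sum_l (c y 0 l - c' y 0 l) ^+ 2) ->
  \int[mu]_(y in `[0, 1]) g y <= sqdist c c'.
Proof.
move=> /continuous_clamp Cc /continuous_clamp Cc' Cg gc.
rewrite -sqdist_clamp; apply: le_Rintegral => //.
- exact: continuous_integrable.
- apply: continuous_integrable; apply: continuous_sum => l y.
  under eq_fun do rewrite expr2.
  by apply: cvgM; apply: cvgB; exact: continuous_coord.
- move=> y y01; rewrite clamp_id; last exact: y01.
  exact: gc.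
Qed.

Lemma le_sum_sqr p (c c' : 'rV[R]_p) l :
  (c 0 l - c' 0 l) ^+ 2 <= \sum_l (c 0 l - c' 0 l) ^+ 2.
Proof. by rewrite (bigD1 l)//= lerDl sumr_ge0// => *; exact: sqr_ge0. Qed.

(** Free of dynamics: the target [P] need only be continuous, at each point of [K], for the distance
    [sqdist] of the inputs. *)
Lemma operator_approximation p q (Z : topologicalType) (K : set Z)
    (c : Z -> R -> 'rV[R]_p) (P : Z -> R -> 'rV[R]_q) (B : R) :
    compact K ->
    (forall z, K z -> {within `[0, 1], continuous (c z)}) ->
    (forall z y l, K z -> y \in `[0, 1] -> `|c z y 0 l| <= B) ->
    (forall z, K z -> is_C1_01 (P z)) ->
    (forall z r, K z -> 0 < r ->
      \forall z' \near z, K z' -> sqdist (c z') (c z) < r) ->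
    (forall z eps, K z -> 0 < eps -> exists2 r, 0 < r &
      forall z', K z' -> sqdist (c z') (c z) < r ->
      forall s a, s \in `[0, 1] -> `|P z' s 0 a - P z s 0 a| <= eps) ->
  forall eps, 0 < eps -> exists N : neural_operator R p q,
    forall z, K z -> is_C1_01 (neural_operator_eval N (c z)) /\
      forall s a, s \in `[0, 1] ->
        `|P z s 0 a - neural_operator_eval N (c z) s 0 a| <= eps.
Proof.
move=> cK Cc cB CP near_c Pcont eps eps0.
pose e := eps / 2; have e0 : 0 < e by rewrite divr_gt0.
have /choice[r rP] : forall z, exists r, 0 < r /\ (K z ->
    forall z', K z' -> sqdist (c z') (c z) < r ->
    forall s a, s \in `[0, 1] -> `|P z' s 0 a - P z s 0 a| <= e).
  move=> z.
  have [Kz|nKz] := pselect (K z); last by exists 1.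
  by have [r r0 rP] := Pcont z e Kz e0; exists r.
have r0 z : 0 < r z by case: (rP z).
(* Covering with half the radius puts some centre within [r / 2]; once squared this is [r ^+ 2 / 4],
   the threshold under which the selector of that centre is near 1. *)
have [s [sK scov]] : exists s : seq Z, (forall z, z \in s -> K z) /\
    forall z, K z -> exists2 z0, z0 \in s &
      (K z -> sqdist (c z) (c z0) < r z0 / 2).
  apply: (@compact_finite_cover _ _
    (fun z0 => [set z | K z -> sqdist (c z) (c z0) < r z0 / 2])) => // z Kz.
  by apply: near_c => //; rewrite divr_gt0.
pose J := size s; pose Zc (j : 'I_J) := tnth (in_tuple s) j.
have ZcK j : K (Zc j) by apply: sK; exact: mem_tnth.
have /choice[M0 MP] : forall j : 'I_J, exists M0, 0 <= M0 /\
    forall s a, s \in `[0, 1] -> `|P (Zc j) s 0 a| <= M0.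
  move=> j.
  have CPj : {within `[0, 1], continuous (fun t => `|P (Zc j) t|)}.
    move=> t; apply: cvg_norm; exact: (C1_continuous (CP _ (ZcK j))).
  have [t _ tmax] := EVT_max (@ler01 R) CPj.
  exists `|P (Zc j) t|; split=> // t' a t'01.
  by apply: le_trans (tmax _ t'01); exact: ler_coord_norm.
pose M := \sum_j M0 j.
have M_ge0 : 0 <= M by apply: sumr_ge0 => j _; case: (MP j).
have PM j t a : t \in `[0, 1] -> `|P (Zc j) t 0 a| <= M.
  move=> t01; apply: le_trans ((MP j).2 t a t01) _.
  rewrite /M (bigD1 j)//= lerDl; apply: sumr_ge0 => l _; by case: (MP l).
(* Makes the second term of [blend_error] equal to [e], for a total error of [e + e = eps]. *)
pose eta := e / ((J%:R + 1) * (2 * M + e)).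
have J1 : 0 < J%:R + 1 :> R by rewrite ltr_wpDl.
have Me : 0 < 2 * M + e by rewrite ltr_wpDl// mulr_ge0.
have eta0 : 0 < eta by rewrite divr_gt0// mulr_gt0.
(* Bounds the squares of [sqdist] on [K]: the selectors are controlled on $[0,\mathrm{Bd}]$ only. *)
pose Bd := (\sum_(l < p) (2 * B) ^+ 2) ^+ 2.
have sqB z z' : K z -> K z' -> sqdist (c z) (c z') ^+ 2 <= Bd.
  move=> Kz Kz'.
  have H : sqdist (c z) (c z') <= \sum_(l < p) (2 * B) ^+ 2.
    apply: sqdist_le => [||y y01]; [exact: Cc|exact: Cc|].
    apply: ler_sum => l _.
    have := cB _ _ l Kz y01; have := cB _ _ l Kz' y01.
    rewrite !ler_norml => /andP[? ?] /andP[? ?].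
    by nra.
  by rewrite lerXn2r// nnegrE ?(le_trans _ H)// sqdist_ge0.
have /choice[sel selP] : forall j : 'I_J, exists sel : R -> R,
    (forall (X I : Type) (v : I -> X -> R) g, polynomial_in v g ->
       polynomial_in v (fun x => sel (g x))) /\
    forall t, 0 <= t <= Bd -> [/\ 0 <= sel t <= 1,
      t <= r (Zc j) ^+ 2 / 4 -> 1 - eta <= sel t &
      r (Zc j) ^+ 2 <= t -> sel t <= eta].
  move=> j.
  by apply: selection_polynomial => //; rewrite exprn_gt0.
pose h (i : 'I_p + bool) (x : 'rV[R]_(p + 1)) : R :=
  match i with
  | inl l => x 0 (lshift 1 l)
  | inr true => \sum_l x 0 (lshift 1 l) ^+ 2
  | inr false => 1
  end.
(* Against the constant channel, the kernel reproduces the curve of each centre;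
   the two values of [d] undo the squaring, as [P = ((P + 1)^2 - P^2 - 1) / 2]. *)
pose k (i : 'I_p + bool) (t : 'I_J + 'I_J * 'I_q * bool) (x y : R) : R :=
  match i, t with
  | inl l, inl j => -2 * c (Zc j) (clamp y) 0 l
  | inr true, inl _ => 1
  | inr false, inr (j, a, d) => P (Zc j) (clamp x) 0 a + d%:R
  | _, _ => 0
  end.
pose b (t : 'I_J + 'I_J * 'I_q * bool) : R :=
  if t is inl j
  then \int[mu]_(y in `[0, 1]) \sum_l c (Zc j) (clamp y) 0 l ^+ 2 else 0.
pose G (a : 'I_q) (y : 'I_J + 'I_J * 'I_q * bool -> R) : R :=
  \sum_j blend (fun l => sel l (y (inl l))) j *
    ((y (inr (j, a, true)) - y (inr (j, a, false)) - 1) * 2^-1).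
have PolyG a : polynomial_in (fun t y => y t) (G a).
  apply: polynomial_sum => j; apply: polynomial_mul.
    apply: polynomial_mul.
      by apply: (selP j).1; exact: polynomial_var.
    apply: polynomial_prod => l; apply: polynomial_sub.
      exact: polynomial_cst.
    by apply: (selP l).1; exact: polynomial_var.
  apply: polynomial_mul; last exact: polynomial_cst.
  apply: polynomial_sub; last exact: polynomial_cst.
  by apply: polynomial_sub; exact: polynomial_var.
have [|||//|N NE] := @shallow_operator R p q _ _ h k b G.
- by rewrite card_sum card_bool addn_gt0 orbT.
- case=> [l|[]]; rewrite /h.
  + exact: (polynomial_var (@coordinate R (p + 1)) (lshift 1 l)).
  + apply: polynomial_sum => l; apply: polynomial_exp.
    exact: (polynomial_var (@coordinate R (p + 1)) (lshift 1 l)).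
  + exact: polynomial_cst.
- have Cc' j : continuous (fun y => c (Zc j) (clamp y)).
    by apply: continuous_clamp; exact: Cc.
  have CP' j : continuous (fun x => P (Zc j) (clamp x)).
    by apply: continuous_clamp; apply: C1_continuous; exact: CP.
  case=> [l|[]] [j|[[j a] d]] z; rewrite /k; try exact: cvg_cst.
    apply: cvgM; first exact: cvg_cst.
    by apply: (@cvg_comp _ _ _ snd (fun y => c (Zc j) (clamp y) 0 l) _
      (nbhs z.2)); [exact: cvg_snd|exact: (continuous_coord (Cc' j))].
  apply: cvgD; last exact: cvg_cst.
  by apply: (@cvg_comp _ _ _ fst (fun x => P (Zc j) (clamp x) 0 a) _
    (nbhs z.1)); [exact: cvg_fst|exact: (continuous_coord (CP' j))].
exists N => z Kz.
pose Y x (t : 'I_J + 'I_J * 'I_q * bool) : R :=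
  match t with
  | inl j => sqdist (c z) (c (Zc j)) ^+ 2
  | inr (j, a, d) => (P (Zc j) x 0 a + d%:R) ^+ 2
  end.
have NY x : x \in `[0, 1] ->
    neural_operator_eval N (c z) x = \row_a G a (Y x).
  move=> x01; rewrite NE; apply/rowP => a; rewrite !mxE; congr (G a _).
  apply/funext => t.
  under eq_Rintegral => y _.
    rewrite big_sumType big_bool /h /=.
    under eq_bigr do rewrite row_mxEl.
    under [X in _ + (X * _ + _)]eq_bigr do rewrite row_mxEl.
    over.
  case: t => [j|[[j a'] d]]; rewrite /Y /b /k; congr (_ ^+ 2).
    rewrite -[RHS]sqdist_clamp -sqdist_expand; last 2 first.
    - by apply: continuous_clamp; exact: Cc.
    - by apply: continuous_clamp; exact: Cc.
    congr (_ + _); apply: eq_Rintegral => y; rewrite inE => y01.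
    by rewrite !mulr1 mulr0 addr0 (clamp_id y01).
  rewrite add0r.
  under eq_Rintegral => y _.
    rewrite big1 => [|l _]; last by rewrite mulr0.
    rewrite mulr0 !add0r mul1r clamp_id//.
    over.
  exact: Rintegral01_cst.
split.
  (* For fixed [z] the output is on $[0,1]$ a polynomial in constants and in the coordinates of the
     curves of the centres, hence $C^1$ although kernels are only continuous. *)
  apply: (@eq_C1 _ _ (fun x => \row_a G a (Y x))) => [t t01|]; first by rewrite NY.
  apply: C1_row => a; under eq_fun do rewrite mxE.
  apply: (@C1_polynomial _ _ _ _ Y _ _ (PolyG a)) => -[j|[[j a'] d]] /=.
    exact: C1_cst.
  under eq_fun do rewrite expr2.
  have CPj : is_C1_01 (fun x => P (Zc j) x 0 a' + d%:R : R^o).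
    exact: C1_add (C1_coord a' (CP _ (ZcK j))) (C1_cst (d%:R : R^o)).
  exact: (C1_scale CPj CPj).
move=> x a x01; rewrite NY// mxE.
have [z0 z0s] := scov z Kz; move=> /(_ Kz) z0z.
have [j0 z0E] : exists j0, Zc j0 = z0.
  have z0i : (index z0 s < J)%N by rewrite index_mem.
  by exists (Ordinal z0i); rewrite /Zc (tnth_nth z0)/= nth_index.
have sq01 j : 0 <= sqdist (c z) (c (Zc j)) ^+ 2 <= Bd.
  by rewrite exprn_ge0 ?sqdist_ge0// sqB.
have closeP j : sqdist (c z) (c (Zc j)) < r (Zc j) ->
    `|P z x 0 a - P (Zc j) x 0 a| <= e.
  by move=> zj; apply: (rP (Zc j)).2.
have -> : G a (Y x) = \sum_j blend
    (fun l => sel l (sqdist (c z) (c (Zc l)) ^+ 2)) j * P (Zc j) x 0 a.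
  by apply: eq_bigr => j _; congr (_ * _); rewrite /Y /=; field.
have far_or j : `|P z x 0 a - P (Zc j) x 0 a| <= e \/
    sel j (sqdist (c z) (c (Zc j)) ^+ 2) <= eta.
  have [/closeP|rj] := ltP (sqdist (c z) (c (Zc j))) (r (Zc j)); first by left.
  right; have [_ _] := (selP j).2 _ (sq01 j); apply.
  by rewrite lerXn2r// nnegrE ?sqdist_ge0// ltW.
have zj0 : `|P z x 0 a - P (Zc j0) x 0 a| <= e.
  apply: closeP; rewrite z0E; apply: lt_le_trans z0z _.
  by have := r0 z0; lra.
apply: le_trans (@blend_error _ _ _ _ _ M e eta _ _ far_or _ _ _ _) _.
- by move=> j; case: ((selP j).2 _ (sq01 j)).
- exists j0; have [_ + _] := (selP j0).2 _ (sq01 j0); apply.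
  rewrite z0E (_ : r z0 ^+ 2 / 4 = (r z0 / 2) ^+ 2); last by field.
  by rewrite lerXn2r// ?nnegrE ?sqdist_ge0 ?divr_ge0// ltW.
- by move=> j; exact: PM.
- have := PM j0 x a x01; move: zj0; rewrite !ler_norml; lra.
- exact: ltW.
- exact: ltW.
rewrite -mulrA /eta divfK; last by rewrite gt_eqF// mulr_gt0.
by rewrite /e; lra.
Qed.

End Approximation.

(** * Predictors *)

(** The first component of the jet suffices: the $C^1$ topology is finer than that of uniform
    convergence. *)
Lemma C1_topology_near (R : realType) (V : normedModType R) (u : C1_01 V) d :
  0 < d ->
  nbhs u [set v : C1_01 V | forall s, s \in `[0, 1] -> `|v s - u s| < d].
Proof.
move=> d0.
have jc : {for u, continuous (@C1_jet R V)} by apply: initial_continuous.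
pose W := [set h : {uniform` [set` `[0, 1 : R]] -> V} |
  forall s, s \in `[0, 1] -> `|h s - u s| < d].
have nW : nbhs ((C1_jet u).1) W.
  apply/uniform_nbhs; exists [set xy | ball xy.1 d xy.2]; split.
    exact: entourage_ball (PosNum d0).
  move=> h H s s01; rewrite distrC; have := H s s01.
  by rewrite /= -ball_normE.
exact: (jc _ (cvg_fst nW)).
Qed.

Section Predictor.
Context {R : realType} {n m : nat} (i : 'I_m).
Implicit Types z : predictor_dom R n i.

Lemma predictor_input_X z y (a : 'I_n) :
  predictor_input z y 0 (lshift 1 (lshift (m - i) a)) = z.1.1 0 a.
Proof. by case: z => -[X U] phi; rewrite /predictor_input !row_mxEl. Qed.

Lemma predictor_input_U z y (k : 'I_(m - i)) :
  predictor_input z y 0 (lshift 1 (rshift n k)) = z.1.2 k y.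
Proof.
by case: z => -[X U] phi; rewrite /predictor_input row_mxEl row_mxEr mxE.
Qed.

Lemma predictor_input_phi z y :
  predictor_input z y 0 (rshift (n + (m - i)) 0) = z.2.
Proof. by case: z => -[X U] phi; rewrite /predictor_input row_mxEr mxE. Qed.

Lemma predictor_input_continuous z :
  {within `[0, 1], continuous (predictor_input z)}.
Proof.
apply/C1_continuous/C1_row => l.
case: (fintype.split_ordP l) => [{}l ->|{}l ->]; last first.
  rewrite ord1; under eq_fun do rewrite predictor_input_phi; exact: C1_cst.
case: (fintype.split_ordP l) => [a ->|k ->].
  by under eq_fun do rewrite predictor_input_X; exact: C1_cst.
by under eq_fun do rewrite predictor_input_U; exact: C1_funP.
Qed.

Lemma predictor_input_near z d : 0 < d ->
  \forall z' \near z, forall y l, y \in `[0, 1] ->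
    `|predictor_input z' y 0 l - predictor_input z y 0 l| <= d.
Proof.
move=> d0.
have nX : nbhs z [set z' : predictor_dom R n i | `|z'.1.1 - z.1.1| < d].
  have : (fun z' : predictor_dom R n i => z'.1.1) @ z --> z.1.1.
    by apply: (@cvg_comp _ _ _ fst fst _ (nbhs z.1)); exact: cvg_fst.
  by move=> /cvgrPdist_lt/(_ _ d0); apply: filterS => z'; rewrite distrC.
pose Q k : set (predictor_dom R n i) :=
  [set z' : predictor_dom R n i |
    forall y, y \in `[0, 1] -> `|z'.1.2 k y - z.1.2 k y| < d].
have nU : nbhs z [set z' : predictor_dom R n i | forall k, Q k z'].
  apply: (@filter_forall _ _ Q (nbhs z) _) => k.
  have : (fun z' : predictor_dom R n i => z'.1.2 k) @ z --> z.1.2 k.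
    apply: (@cvg_comp _ _ _ (fun z' : predictor_dom R n i => z'.1.2)
      (fun U => U k) _ (nbhs z.1.2)).
      by apply: (@cvg_comp _ _ _ fst snd _ (nbhs z.1));
        [exact: cvg_fst|exact: cvg_snd].
    exact: (@proj_continuous _ (fun=> C1_01 R) k z.1.2).
  by move=> cU; exact: (cU _ (C1_topology_near (z.1.2 k) d0)).
have nphi : nbhs z [set z' : predictor_dom R n i | `|z'.2 - z.2| < d].
  have : (fun z' : predictor_dom R n i => z'.2) @ z --> z.2 by exact: cvg_snd.
  by move=> /cvgrPdist_lt/(_ _ d0); apply: filterS => z'; rewrite distrC.
apply: filterS3 nX nU nphi => z' HX HU Hphi y l y01.
case: (fintype.split_ordP l) => [{}l ->|{}l ->]; last first.
  by rewrite ord1 !predictor_input_phi ltW.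
case: (fintype.split_ordP l) => [a ->|k ->].
  rewrite !predictor_input_X ltW//; apply: le_lt_trans HX.
  by have := ler_coord_norm (z'.1.1 - z.1.1) a; rewrite !mxE.
by rewrite !predictor_input_U ltW// HU.
Qed.

Lemma predictor_input_sqdist_near z r : 0 < r ->
  \forall z' \near z, sqdist (predictor_input z') (predictor_input z) < r.
Proof.
move=> r0; pose N : R := (n + (m - i) + 1)%:R + 1.
have N0 : 0 < N by rewrite ltr_wpDl.
(* Since [d <= 1], squares of errors are at most [d], and their sum over the coordinates is at most
   [N * d <= r / 2]. *)
pose d := Num.min 1 (r / (2 * N)).
have d0 : 0 < d by rewrite lt_min ltr01 divr_gt0// mulr_gt0.
apply: filterS (predictor_input_near z d0) => z' H.
apply: (@le_lt_trans _ _ (r / 2)); last by rewrite ltr_pdivrMr// ltr_pMr// ltr1n.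
apply: sqdist_le; try exact: predictor_input_continuous.
move=> y y01; apply: (@le_trans _ _ (\sum_(l < n + (m - i) + 1) d)).
  apply: ler_sum => l _; have := H y l y01.
  have d1 : d <= 1 by rewrite ge_min lexx.
  rewrite -real_normK ?num_real// => Hd.
  by rewrite expr2 -[leRHS]mulr1 ler_pM// (le_trans Hd).
rewrite sumr_const card_ord -[leLHS]mulr_natr.
have dr : d <= r / (2 * N) by rewrite ge_min lexx orbT.
apply: (@le_trans _ _ (r / (2 * N) * N)); last first.
  by rewrite le_eqVlt; apply/orP; left; apply/eqP; field; rewrite gt_eqF.
by apply: ler_pM => //; [exact: ltW|rewrite /N lerDl].
Qed.

End Predictor.

(** * Continuity of the predictors for the distance of their inputs *)

Section Stable_predictor.
Context {R : realType} {n m : nat}.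
Local Notation mu := (@lebesgue_measure R).
Variables (f : 'rV[R]_n -> 'rV[R]_m -> 'rV[R]_n)
  (kappa : 'I_m -> 'rV[R]_n -> R) (i : 'I_m).
Hypothesis f_loclip : [locally [lipschitz (f z.1 z.2) | z in
                            [set: ('rV[R]_n * 'rV[R]_m)%type]]].
Hypothesis kappa_C1 : forall j, C1_on_space (kappa j).

(** Hides the cast and the split of indices: the estimates only use that a coordinate is a feedback
    law or an external input. *)
Lemma mixed_controlE j :
  (exists j' : 'I_m, forall (x : 'rV[R]_n) (u : 'I_(m - i) -> R),
     mixed_control kappa i x u 0 j = kappa j' x) \/
  (exists k, forall (x : 'rV[R]_n) (u : 'I_(m - i) -> R),
     mixed_control kappa i x u 0 j = u k).
Proof.
rewrite /mixed_control.
case E : (fintype.split (cast_ord (esym (subnKC (ltnW (ltn_ord i)))) j)) => [l|k].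
  by left; eexists => x u; rewrite mxE E.
by right; exists k => x u; rewrite mxE E.
Qed.

Definition closed_loop (x : 'rV[R]_n) (u : 'rV[R]_(m - i)) : 'rV[R]_n :=
  f x (mixed_control kappa i x (fun k => u 0 k)).

Lemma closed_loop_lipschitz : lipschitz_on_balls closed_loop.
Proof.
move=> M.
have /choice[Lk Lk0] : forall j, exists L, 0 <= L /\ forall x y : 'rV[R]_n,
    `|x| <= Num.max M 0 -> `|y| <= Num.max M 0 ->
    `|kappa j x - kappa j y| <= L * `|x - y|.
  move=> j; have [L L0 HL] := lipschitz_C1 (Num.max M 0) (kappa_C1 j).
  by exists L; split => //; exact: ltW.
set M' := Num.max M 0 in Lk0.
have M'0 : 0 <= M' by rewrite le_max lexx orbT.
have MM' : M <= M' by rewrite le_max lexx.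
pose S := \sum_j Lk j.
have S0 : 0 <= S by apply: sumr_ge0 => j _; case: (Lk0 j).
have LS j : Lk j <= S.
  by rewrite /S (bigD1 j)//= lerDl; apply: sumr_ge0 => l _; case: (Lk0 l).
pose T := \sum_j `|kappa j 0|.
have T0 : 0 <= T by apply: sumr_ge0.
have kT j : `|kappa j 0| <= T by rewrite /T (bigD1 j)//= lerDl sumr_ge0.
(* Bounds all controls on the ball: a feedback law by its value at 0 plus its variation, an external
   input by [M']. Then [f] is Lipschitz on the product of the two compact balls. *)
pose M2 := T + S * M' + M'.
have M20 : 0 <= M2 by rewrite !addr_ge0// mulr_ge0.
have [L L0 HL] := lipschitz_on_compact
  (compact_setX (@compact_ball R n M') (@compact_ball R m M2)) f_loclip.
exists (L * (2 + S)); first by rewrite mulr_gt0// ltr_wpDr.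
move=> x x' u u' xM x'M uM u'M.
have {}xM := le_trans xM MM'; have {}x'M := le_trans x'M MM'.
have {}uM := le_trans uM MM'; have {}u'M := le_trans u'M MM'.
have mixM y (v : 'rV[R]_(m - i)) : `|y| <= M' -> `|v| <= M' ->
    `|mixed_control kappa i y (fun k => v 0 k)| <= M2.
  move=> yM vM; apply: ler_row_norm => // j.
  have [[j' ->]|[k ->]] := mixed_controlE j.
    have [L'0 /(_ y 0 yM)] := Lk0 j'; rewrite normr0 subr0 => /(_ M'0) H.
    rewrite -[kappa j' y](subrK (kappa j' 0)) addrC.
    apply: le_trans (ler_normD _ _) _; rewrite /M2 -addrA lerD// ler_wpDr//.
    by apply: le_trans H _; rewrite ler_pM.
  apply: le_trans (ler_coord_norm v k) _; apply: le_trans vM _.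
  by rewrite /M2 lerDr addr_ge0// mulr_ge0.
have mixD : `|mixed_control kappa i x (fun k => u 0 k) -
      mixed_control kappa i x' (fun k => u' 0 k)| <= S * `|x - x'| + `|u - u'|.
  apply: ler_row_norm => [|j]; first by rewrite addr_ge0// mulr_ge0.
  have rowB (A B : 'rV[R]_m) : (A - B) 0 j = A 0 j - B 0 j by rewrite !mxE.
  rewrite rowB.
  have [[j' E]|[k E]] := mixed_controlE j; rewrite !E.
    apply: ler_wpDr => //; apply: le_trans ((Lk0 j').2 _ _ xM x'M) _.
    exact: ler_wpM2r.
  apply: ler_wpDl; first exact: mulr_ge0.
  by have := ler_coord_norm (u - u') k; rewrite !mxE.
have := HL (x, mixed_control kappa i x (fun k => u 0 k))
  (x', mixed_control kappa i x' (fun k => u' 0 k))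
  (conj xM (mixM _ _ xM uM)) (conj x'M (mixM _ _ x'M u'M)).
rewrite /closed_loop /= => /le_trans; apply.
rewrite -mulrA; apply: ler_wpM2l; first exact: ltW.
rewrite prod_normE/= ge_max; apply/andP; split => /=.
  have := normr_ge0 (x - x'); have := normr_ge0 (u - u'); nra.
apply: le_trans mixD _.
have := normr_ge0 (x - x'); have := normr_ge0 (u - u'); nra.
Qed.

Lemma predictor_solution z (p : R -> 'rV[R]_n) : is_predictor f kappa z p ->
  integral_solution closed_loop z.1.1 z.2 (fun t => \row_k z.1.2 k (clamp t))
    (fun t => p (clamp t)).
Proof.
case: z => -[X U] phi /= pP s sI.
have s01 : s \in `[0, 1] by rewrite in_itv.
rewrite clamp_id// pP//; congr (_ + _ *: _); apply/rowP => j; rewrite !mxE.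
apply: eq_Rintegral => t; rewrite inE /= in_itv /= => /andP[t0 ts].
have t01 : t \in `[0, 1].
  by rewrite in_itv /= t0 (le_trans ts)//; case/andP: sI.
rewrite /closed_loop clamp_id//; congr (f _ _ 0 j); congr (mixed_control _ _ _ _).
by apply/funext => k; rewrite mxE.
Qed.

Lemma predictor_continuous_sqdist (P : predictor_dom R n i -> C1_01 'rV[R]_n)
    (K : set (predictor_dom R n i)) (M Phi : R) :
    (forall z, K z -> is_predictor f kappa z (P z)) -> 0 < Phi ->
    (forall z, K z -> 0 <= z.2 <= Phi) -> 0 <= M ->
    (forall z k s, K z -> s \in `[0, 1] -> `|z.1.2 k s| <= M) ->
  forall z eps, K z -> 0 < eps -> exists2 r, 0 < r & forall z', K z' ->
    sqdist (predictor_input z') (predictor_input z) < r ->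
  forall s a, s \in `[0, 1] -> `|P z' s 0 a - P z s 0 a| <= eps.
Proof.
move=> PP Phi0 KPhi M0 KM z eps Kz eps0.
pose u (z : predictor_dom R n i) (t : R) : 'rV[R]_(m - i) := \row_k z.1.2 k (clamp t).
have Cu z' : continuous (u z').
  apply: continuous_row => k; apply: (@continuous_clamp _ _ (z'.1.2 k)).
  exact: C1_continuous (C1_funP _).
have CP z' : continuous (fun t => P z' (clamp t)).
  by apply: continuous_clamp; exact: C1_continuous (C1_funP _).
have uM z' t : K z' -> `|u z' t| <= M.
  move=> Kz'; apply: ler_row_norm => // k; rewrite mxE.
  exact: KM (clamp_in t).
have [d d0 Hd] := integral_solution_stable closed_loop_lipschitz Phi0 (CP z)
  (Cu z) (fun t => uM z t Kz) (predictor_solution (PP z Kz)) eps0.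
(* A component of the input difference that is constant in time satisfies $v^2=\int v^2\le$
   [sqdist], so [d ^+ 2] controls [X] and [phi] at once. *)
exists (d ^+ 2) => [|z' Kz' zz' s a s01]; first exact: exprn_gt0.
have Cin := @predictor_input_continuous R n m i.
have entry v l : (forall y,
      predictor_input z' y 0 l - predictor_input z y 0 l = v) -> `|v| <= d.
  move=> vE; have d_ge0 := ltW d0.
  rewrite -(@ler_pXn2r _ 2) ?nnegrE// real_normK ?num_real//.
  apply: le_trans (ltW zz'); rewrite -(Rintegral01_cst (v ^+ 2)).
  apply: le_sqdist => //; first by move=> y; exact: cvg_cst.
  by move=> y _; rewrite -(vE y); exact: le_sum_sqr.
have := Hd z'.1.1 z'.2 (u z') _ (CP z') (Cu z') (fun t => uM z' t Kz')
  (KPhi z' Kz') (predictor_solution (PP z' Kz')).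
move=> H.
have {}H : `|P z' (clamp s) - P z (clamp s)| <= eps.
  apply: H; last by move: s01; rewrite in_itv.
  - apply: ler_row_norm => [|b]; first exact: ltW.
    rewrite !mxE; apply: (entry _ (lshift 1 (lshift (m - i) b))) => y.
    by rewrite !predictor_input_X.
  - apply: (entry _ (rshift (n + (m - i)) 0)) => y.
    by rewrite !predictor_input_phi.
  have Cuu : continuous (fun t => `|u z' t - u z t|).
    by move=> t; apply: cvg_norm; apply: cvgB; exact: Cu.
  have [d1 d2] : 0 < (2 * d)^-1 /\ 0 < d / 2.
    by rewrite invr_gt0 mulr_gt0// divr_gt0.
  (* Stands for Cauchy-Schwarz: from $2d(\int|u'-u|-d/2)<d^2$ follows $\int|u'-u|<d$. *)
  have : \int[mu]_(t in `[0, 1]) (2 * d * (`|u z' t - u z t| - d / 2))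
      <= sqdist (predictor_input z') (predictor_input z).
    apply: le_sqdist => //.
      move=> t; apply: cvgM; first exact: cvg_cst.
      by apply: cvgB; [exact: Cuu|exact: cvg_cst].
    move=> y y01; rewrite -ler_pdivlMl ?mulr_gt0// lerBlDr.
    have S0 : 0 <= \sum_l (predictor_input z' y 0 l - predictor_input z y 0 l) ^+ 2.
      by apply: sumr_ge0 => l _; exact: sqr_ge0.
    apply: ler_row_norm => [|k]; first by rewrite addr_ge0 ?mulr_ge0// ltW.
    rewrite !mxE clamp_id// -!(predictor_input_U _ y k).
    have := le_sum_sqr (predictor_input z' y) (predictor_input z y)
      (lshift 1 (rshift n k)).
    set w := _ - _; rewrite -(ler_pM2l d1) => H1.
    apply: le_trans (lerD H1 (lexx _)).
    (* AM-GM: [|w| <= w^2 / (2d) + d / 2] *)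
    rewrite -subr_ge0.
    have -> : (2 * d)^-1 * w ^+ 2 + d / 2 - `|w| = (2 * d)^-1 * (`|w| - d) ^+ 2.
      by rewrite -(real_normK (num_real w)); field; rewrite gt_eqF.
    by rewrite mulr_ge0 ?sqr_ge0// ltW.
  rewrite RintegralZl//; last first.
    by apply: continuous_integrable => t; apply: cvgB; [exact: Cuu|exact: cvg_cst].
  rewrite RintegralB//; last 2 first.
  - exact: continuous_integrable.
  - by apply: continuous_integrable => t; exact: cvg_cst.
  rewrite Rintegral01_cst => /le_lt_trans/(_ zz').
  rewrite expr2 -ltr_pdivlMl ?mulr_gt0// => /ltW; rewrite lerBlDr => /le_trans; apply.
  by rewrite le_eqVlt; apply/orP; left; apply/eqP; field; rewrite gt_eqF.
rewrite clamp_id// in H; apply: le_trans H.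
by have := ler_coord_norm (P z' s - P z s) a; rewrite !mxE.
Qed.

End Stable_predictor.

(** * Euclidean error bounds and conclusion *)

(** The factor $n+1$, cruder than $\sqrt n$, is positive also for [n = 0] and can be divided by. *)
Lemma enorm_le (R : realType) n (v : 'rV[R]_n) d : 0 <= d ->
  (forall j, `|v 0 j| <= d) -> enorm v <= (n%:R + 1) * d.
Proof.
move=> d0 vd; have nd0 : 0 <= (n%:R + 1) * d by rewrite mulr_ge0// addr_ge0.
rewrite /enorm -[leRHS]ger0_norm// -sqrtr_sqr ler_wsqrtr//.
apply: (@le_trans _ _ (\sum_(j < n) d ^+ 2)).
  apply: ler_sum => j _; rewrite -real_normK ?num_real//.
  by rewrite lerXn2r// nnegrE.
rewrite sumr_const card_ord exprMn -[leLHS]mulr_natl; apply: ler_wpM2r.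
  exact: sqr_ge0.
have := ler0n R n; nra.
Qed.

Lemma bounded_set_le (R : realType) (V : normedModType R) (A : set V) :
  bounded_set A -> exists2 M, 0 < M & forall x, A x -> `|x| <= M.
Proof.
move=> /pinfty_ex_gt0[M M0 HM]; exists M => // x Ax; exact: HM.
Qed.

Theorem theorem6 (R : realType) (n m : nat)
    (f : 'rV[R]_n -> 'rV[R]_m -> 'rV[R]_n)
    (f_loclip : [locally [lipschitz (f z.1 z.2) | z in
                            [set: ('rV[R]_n * 'rV[R]_m)%type]]])
    (f00 : f 0 0 = 0)
    (kappa : 'I_m -> 'rV[R]_n -> R)
    (kappa_C1 : forall j, C1_on_space (kappa j))
    (kappa_gas : globally_asymptotically_stable
                   (fun x => f x (\row_j kappa j x)))
    (calX : set 'rV[R]_n) (calU : set R) (Phi : set R)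
    (calX_dom : bounded_domain calX)
    (calU_dom : bounded_domain calU)
    (Phi_dom : bounded_domain Phi)
    (Phi_gt0 : forall phi, Phi phi -> 0 < phi)
    (f_lip : exists2 Cf : R, 0 < Cf &
      forall (x1 x2 : 'rV[R]_n) (u1 u2 : 'rV[R]_m),
        calX x1 -> calX x2 ->
        (forall j, calU (u1 0 j)) -> (forall j, calU (u2 0 j)) ->
        enorm (f x1 u1 - f x2 u2) <=
          Cf * (enorm (x1 - x2) + \sum_j `|u1 0 j - u2 0 j|))
    (P : forall i : 'I_m, predictor_dom R n i -> C1_01 'rV[R]_n)
    (P_predictor : forall i (z : predictor_dom R n i), 0 < z.2 ->
      is_predictor f kappa z (P i z))
    (K : forall i : 'I_m, set (predictor_dom R n i))
    (K_compact : forall i, compact (K i))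
    (K_sub : forall i (z : predictor_dom R n i), K i z ->
      [/\ calX z.1.1,
          forall k s, s \in `[0, 1] -> calU (z.1.2 k s) &
          Phi z.2]) :
  forall eps : R, 0 < eps ->
  exists N : forall i : 'I_m, neural_operator R (n + (m - i) + 1) n,
  forall i,
    (forall z, K i z -> is_C1_01 (neural_operator_eval (N i) (predictor_input z)))
    /\
    (ereal_sup [set Linf_norm (fun s => P i z s -
        neural_operator_eval (N i) (predictor_input z) s)%R | z in K i]
      < eps%:E)%E.
Proof.
move=> eps eps0.
have [MX MX0 HMX] := bounded_set_le (let: And4 _ _ _ b := calX_dom in b).
have [MU MU0 HMU] := bounded_set_le (let: And4 _ _ _ b := calU_dom in b).
have [MP MP0 HMP] := bounded_set_le (let: And4 _ _ _ b := Phi_dom in b).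
(* Coordinate errors of at most [d] give a Euclidean error of at most [eps / 2]; the margin keeps
   the supremum strictly below [eps]. *)
pose d := eps / (2 * (n%:R + 1)).
have n1 : 0 < n%:R + 1 :> R by rewrite ltr_wpDl.
have d0 : 0 < d by rewrite divr_gt0// mulr_gt0.
have H (i : 'I_m) : exists N : neural_operator R (n + (m - i) + 1) n,
    forall z, K i z ->
      is_C1_01 (neural_operator_eval N (predictor_input z)) /\
      forall s a, s \in `[0, 1] ->
      `|P i z s 0 a - neural_operator_eval N (predictor_input z) s 0 a| <= d.
  apply: (@operator_approximation _ _ _ _ (K i) (@predictor_input R n m i)
    (fun z => P i z : R -> 'rV[R]_n) (MX + MU + MP)) => //.
  - by move=> z _; exact: predictor_input_continuous.
  - move=> z y l Kz y01; have [Xz Uz Pz] := K_sub _ _ Kz.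
    case: (fintype.split_ordP l) => [{}l ->|{}l ->]; last first.
      rewrite ord1 predictor_input_phi (le_trans (HMP _ Pz))//.
      by rewrite lerDr addr_ge0// ltW.
    case: (fintype.split_ordP l) => [a ->|k ->].
      rewrite predictor_input_X (le_trans (ler_coord_norm _ _))//.
      by rewrite (le_trans (HMX _ Xz))// -addrA lerDl addr_ge0// ltW.
    rewrite predictor_input_U (le_trans (HMU _ (Uz k y y01)))//.
    by rewrite addrAC lerDr addr_ge0// ltW.
  - by move=> z _; exact: C1_funP.
  - move=> z r Kz r0.
    by apply: filterS (predictor_input_sqdist_near z r0).
  - apply: (predictor_continuous_sqdist f_loclip kappa_C1 (M := MU) (Phi := MP)) => //.
    + by move=> z Kz; apply: P_predictor; have [_ _ /Phi_gt0] := K_sub _ _ Kz.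
    + move=> z Kz; have [_ _ Pz] := K_sub _ _ Kz.
      by rewrite ltW ?Phi_gt0//= (le_trans (ler_norm _))// HMP.
    + exact: ltW.
    + by move=> z k s Kz s01; have [_ Uz _] := K_sub _ _ Kz; apply/HMU/Uz.
exists (fun i => sval (cid (H i))) => i; case: cid => N /= HN.
split=> [z /HN[]//|].
apply: (@le_lt_trans _ _ (eps / 2)%:E); last first.
  by rewrite lte_fin ltr_pdivrMr// ltr_pMr// ltr1n.
apply: ge_ereal_sup => _ [z Kz <-]; apply: ge_ereal_sup => _ [s s01 <-].
rewrite lee_fin (_ : eps / 2 = (n%:R + 1) * d); last first.
  by rewrite /d; field; rewrite gt_eqF.
apply: enorm_le => [|a]; first exact: ltW.
by rewrite !mxE; apply: (HN z Kz).2.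
Qed.
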